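(* Let $\tau:[0,\infty)\to[0,\infty)$ be continuous with $\lim_{t\to\infty}\{t-\tau(t)\}=\infty$, and let $\bar\tau$ be defined by $-\bar{\tau}=\inf_{t\ge 0}\{t-\tau(t)\}$. Let $\sigma:[-\bar\tau,\infty)\to[0,\infty)$ be continuous and such that $$\lim_{t\to\infty}\int_0^t\frac{1}{\sigma(s)}\,ds=\infty,\qquad \lim_{t\to\infty}\sigma(t)=\infty,\qquad \lim_{t\to\infty}\int_{t-\tau(t)}^t\frac{1}{\sigma(s)}\,ds=1,$$ and suppose there exists $\lambda\in[0,\infty]$ such that $\lim_{t\to\infty}\sigma(t)/t=\lambda$. Let $a>b>0$ and let $g:[0,\infty)\to[0,\infty)$ be continuous with $g(0)=0$, $g(x)>0$ for $x>0$, such that there is $\delta_1>0$ with $g\in C^1(0,\delta_1)$ and $g'(x)>0$ for $x\in(0,\delta_1)$, and there is $\beta>1$ with $g'\in \mathrm{RV}_0(\beta-1)$. Let $\psi\in C([-\bar\tau,0];(0,\infty))$. Suppose that the solution $x$ of $$x'(t)=-ag(x(t))+bg(x(t-\tau(t))),\quad t\ge 0;\qquad x(t)=\psi(t),\quad t\in[-\bar\tau,0],$$ obeys $x(t)\to0$ as $t\to\infty$. Let $G(x)=\int_x^1\frac{1}{g(u)}\,du$ for $x>0$. (i) If $\lambda=0$, then $\displaystyle\lim_{t\to\infty}\frac{x(t)}{G^{-1}(t)}=(a-b)^{-1/(\beta-1)}$. (ii) If $0<\lambda<\frac{\beta-1}{\beta}\log(a/b)$, put $q=1-e^{-\lambda}$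 and $\Lambda=\left(a-b\left(\frac{1}{1-q}\right)^{\beta/(\beta-1)}\right)^{-1/(\beta-1)}$. Then $$\Lambda\le\liminf_{t\to\infty}\frac{x(t)}{G^{-1}(t)}\le\limsup_{t\to\infty}\frac{x(t)}{G^{-1}(t)}<+\infty.$$ (iii) If $\frac{\beta-1}{\beta}\log(a/b)<\lambda<+\infty$, then $\displaystyle\lim_{t\to\infty}\frac{\log x(t)}{\log t}=-\frac1\beta\,\frac1\lambda\log\left(\frac ab\right)$. (iv) If $\lambda=\infty$, then $\displaystyle\lim_{t\to\infty}\frac{\log x(t)}{\int_0^t\frac{1}{\sigma(s)}\,ds}=-\frac1\beta\log\left(\frac ab\right)$.
   Context: A function $f$, positive near $0$ on the right, is regularly varying at zero with exponent $\alpha\in\mathbb{R}$, written $f\in\mathrm{RV}_0(\alpha)$, if $\lim_{t\to0^+}f(\lambda t)/f(t)=\lambda^\alpha$ for all $\lambda>0$. A solution of the delay equation is a continuous function $x:[-\bar\tau,\infty)\to(0,\infty)$, differentiable on $[0,\infty)$ (one-sided at $0$), satisfying the equation for all $t\ge0$ and equal to $\psi$ on $[-\bar\tau,0]$; solutions are positive. $G$ is strictly decreasing on $(0,\infty)$ with $G(x)\to\infty$ as $x\to0^+$, and $G^{-1}$ is its inverse. The integrals of $1/\sigma$ over compact intervals are understood to be finite. *)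

(* Defs.v *)
From mathcomp Require Import all_boot all_order all_algebra.
From mathcomp Require Import all_classical all_reals all_analysis.

Set Implicit Arguments.
Unset Strict Implicit.
Unset Printing Implicit Defensive.

Import Order.TTheory GRing.Theory Num.Theory.
Import numFieldNormedType.Exports.

Local Open Scope classical_set_scope.
Local Open Scope ring_scope.

(* Regular variation at zero from the right, with exponent alpha. *)
Definition RV0 (R : realType) (f : R -> R) (alpha : R) : Prop :=
  (\forall t \near 0^'+, 0 < f t) /\
  (forall l : R, 0 < l -> f (l * t) / f t @[t --> 0^'+] --> l `^ alpha).

(* 1 / f with the value +oo (instead of 0 for the inverse in R) at the zeros
   of f, so that zeros of f do count in Lebesgue integrals of 1 / f. *)
Definition recip (R : realType) (f : R -> R) (s : R) : \bar R :=
  ((f s)%:E^-1)%E.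

(* The real number \int_c^d 1 / f for c <= d; it is only meaningful when
   1 / f is integrable on [c, d]. *)
Definition recip_int (R : realType) (f : R -> R) (c d : R) : R :=
  fine (\int[@lebesgue_measure R]_(s in `[c, d]) recip f s)%E.

(* G(x) = \int_x^1 1 / g as an oriented integral (negative for x > 1). *)
Definition bigG (R : realType) (g : R -> R) (x : R) : R :=
  if x <= 1 then recip_int g x 1 else - recip_int g 1 x.

(* The inverse of G on (0, +oo); the default value 1 is only taken outside the
   range of G, which contains [0, +oo) as soon as G tends to +oo at 0+. *)
Definition bigG_inv (R : realType) (g : R -> R) : R -> R :=
  'pinv_(fun=> 1) `]0, +oo[%classic (bigG g).

(* Positive solutions of x'(t) = - a g(x(t)) + b g(x(t - tau(t))) with initial
   function psi on [- taubar, 0]. Functions on [- taubar, +oo) are represented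
   by total functions whose values below - taubar are irrelevant; the
   derivative at 0 is the right derivative. *)
Definition is_solution (R : realType) (tau : R -> R) (taubar a b : R)
    (g psi x : R -> R) : Prop :=
  let rhs (t : R) := - a * g (x t) + b * g (x (t - tau t)) in
  [/\ {within `[- taubar, +oo[, continuous x},
      forall t : R, - taubar <= t -> 0 < x t,
      forall t : R, - taubar <= t <= 0 -> x t = psi t,
      (h^-1 * (x h - x 0) @[h --> 0^'+] --> rhs 0) &
      forall t : R, 0 < t -> is_derive t (1 : R) x (rhs t)].

(* Main.v *)
Require Import Defs.
From mathcomp Require Import all_boot all_order all_algebra.
From mathcomp Require Import all_classical all_reals all_analysis.
From mathcomp Require Import ring lra.

(** Write d t = t - tau t, S t for the integral of 1 / sigma over [0, t] (a
clock in which one delay lasts asymptotically one unit of time), and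
mu = ln (a / b) / beta. The function g is regularly varying with exponent beta
and G with exponent 1 - beta (RV0_of_derive, RV0_primitive). Comparing the
primitives ln and S of 1 / t and 1 / sigma shows that ln t - ln (d t) tends to
lambda when lambda is finite, so d t / t tends to p = exp (- lambda)
(cvg_delay_ratio).

Slow regime. The function z t = G (x t) satisfies
  z' = a - b g (x (d t)) / g (x t),
and the quotient on the right is a regularly varying function, of exponent
- theta with theta = beta / (beta - 1), of the values z (d t) and z t
(primitive_compose_le, primitive_compose_ge). If z t were about k t, then its
slope would be about c = a - b p ^ (- theta); this is positive exactly when
lambda lies below the threshold. A line of small slope is a lower barrier for
z, and any asymptotic lower bound k t with k < c improves itself, as does any
upper bound k t with k > c; hence z t / t tends to c (linear_growth). Since G
is regularly varying, x t / G^-1 t then tends to c ^ (- 1 / (beta - 1))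
(primitive_inv_asymp). For lambda = 0 this is (a - b) ^ (- 1 / (beta - 1)), and
for lambda > 0 it is Lambda, so in that case the lower and upper limits
coincide.

Fast regime. If x behaves like exp (- m S), then g (x (d t)) / g (x t) is about
exp (m beta), and the loss a g (x t) balances the gain b g (x (d t)) for
m = mu. For m > mu a multiple of exp (- m S) is a lower barrier for x, and for
m < mu an upper one (exp_lower_bound, exp_upper_bound). The upper barrier has
to decrease more slowly than the solution where they meet, which holds when
sigma t >= lam t for some lam > mu (beta - 1), that is when lambda lies above
the threshold. Hence ln (x t) / S t tends to - mu (exponential_decay); for
finite lambda, ln t / S t tends to lambda (cvg_ln_clock), which turns the clock
S into ln t. *)

Set Implicit Arguments.
Unset Strict Implicit.
Unset Printing Implicit Defensive.

Import Order.TTheory GRing.Theory Num.Theory.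
Import numFieldNormedType.Exports.

Local Open Scope classical_set_scope.
Local Open Scope ring_scope.

(** * Barriers and comparison of increments *)

Section calculus.
Context {R : realType}.
Implicit Types (f k df dk u du d : R -> R) (P : R -> Prop).

Lemma near_pinftyW P : (\forall t \near +oo, P t) ->
  exists T, 0 < T /\ forall t, T <= t -> P t.
Proof.
move=> [M [_ MP]]; exists (`|M| + 1); split; first by rewrite ltr_wpDl.
by move=> t Mt; apply: MP; have := ler_norm M; lra.
Qed.

Lemma near_pinfty_from P : (exists T, forall t, T <= t -> P t) ->
  \forall t \near +oo, P t.
Proof.
by move=> [T TP]; exists T; split; [exact: num_real|move=> t /ltW; exact: TP].
Qed.

(** The delayed argument also becomes large, so a property that holds
eventually can be used along the whole relevant history of a late time. *)
Lemma near_pinfty_after d P : d t @[t --> +oo] --> +oo ->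
  (\forall t \near +oo, P t) -> \forall t \near +oo, forall s, d t <= s -> P s.
Proof.
move=> /cvgryPgt dy /near_pinftyW[T [_ TP]].
apply: filterS (dy T) => t Tdt s ds; apply: TP; lra.
Qed.

Lemma near_interval P (t : R) : (\forall y \near t, P y) ->
  exists e, 0 < e /\ forall y, t - e < y < t + e -> P y.
Proof.
move=> /nbhs_ballP[e /= e0 eP]; exists e; split=> // y tey; apply: eP.
by rewrite /ball/= ltr_distlC; lra.
Qed.

Lemma is_derive_continuous f (t l : R) : is_derive t 1 f l -> {for t, continuous f}.
Proof.
move=> dft; apply: differentiable_continuous; apply/derivable1_diffP.
exact: ex_derive.
Qed.

Lemma is_derive_segment_continuous f df (s t : R) :
  (forall r, s <= r <= t -> is_derive r 1 f (df r)) ->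
  {within `[s, t], continuous f}.
Proof.
move=> dfr; apply: derivable_within_continuous => r; rewrite in_itv/= => rst.
by have := dfr _ rst => ?; exact: ex_derive.
Qed.

Lemma ler_increment f k df dk (s t : R) : s <= t ->
  (forall r, s <= r <= t -> is_derive r 1 f (df r)) ->
  (forall r, s <= r <= t -> is_derive r 1 k (dk r)) ->
  (forall r, s <= r <= t -> df r <= dk r) ->
  f t - f s <= k t - k s.
Proof.
move=> st dfr dkr le.
have dh r : s <= r <= t -> is_derive r 1 (k \- f) (dk r - df r).
  by move=> rst; have := dfr _ rst; have := dkr _ rst => ? ?; exact: is_deriveB.
have dh' r : r \in `]s, t[ -> is_derive r 1 (k \- f) (dk r - df r).
  by rewrite in_itv/= => /andP[sr rt]; apply: dh; rewrite !ltW.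
have [c] := MVT_segment st dh' (is_derive_segment_continuous dh).
rewrite in_itv/= => cst /= E; have := le _ cst.
have : 0 <= t - s by lra.
nra.
Qed.

Lemma is_derive_le0 f (t l T : R) : T < t -> is_derive t 1 f l ->
  (forall s, T <= s < t -> 0 <= f s) -> f t = 0 -> l <= 0.
Proof.
move=> Tt [dft dftE] f_ge0 ft0.
have : (h^-1 *: (f (h *: 1 + t) - f t)) @[h --> 0^'] --> l.
  by rewrite -dftE; exact: dft.
move=> /cvg_dnbhs_at_left cl.
apply: (ler_cvg_to cl (cvg_cst 0)).
near=> h.
have h0 : h < 0 by near: h; exact: nbhs_left_lt.
have hT : T - t < h by near: h; apply: nbhs_left_gt; lra.
rewrite ft0 subr0 /GRing.scale/= mulr1.
have : 0 <= f (h + t) by apply: f_ge0; lra.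
have : h^-1 < 0 by rewrite invr_lt0.
nra.
Unshelve. all: by end_near. Qed.

(** Barrier principle for equations with delay: at a first zero u comes down
from positive values, so its derivative there cannot be positive. The
condition at the zero may use u >= 0 on the whole past from T1 on, which is
what lets the delayed term be compared. *)
Lemma first_crossing u du (T1 T : R) :
  (forall t, T1 <= t <= T -> 0 < u t) -> T1 <= T ->
  (forall t, T <= t -> is_derive t 1 u (du t)) ->
  (forall t, T <= t -> u t = 0 -> (forall s, T1 <= s <= t -> 0 <= u s) ->
    0 < du t) ->
  forall t, T1 <= t -> 0 < u t.
Proof.
move=> u_gt0 T1T uE cross t T1t; rewrite ltNge; apply/negP => ut0.
have Tt : T < t by rewrite ltNge; apply/negP => tT; have := u_gt0 t; lra.
pose A := [set s | T <= s /\ forall r, T <= r <= s -> 0 < u r].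
have AT : A T.
  split=> // r Tr; apply: u_gt0; lra.
have At s : A s -> s < t.
  move=> [Ts us]; rewrite ltNge; apply/negP => ts; have := us t; lra.
(* sup A is the first zero of u, where cross contradicts the sign of
   the left difference quotients. *)
have supA : has_sup A by split; [exists T|exists t => s /At /ltW].
set t1 := sup A.
have Tt1 : T <= t1 by apply: ub_le_sup => //; exact: supA.2.
have ult1 r : T1 <= r < t1 -> 0 < u r.
  move=> /andP[T1r rt1]; have [rT|Tr] := leP r T; first by apply: u_gt0; lra.
  have [s As rs] := sup_adherent (eps := t1 - r) ltac:(lra) supA.
  by apply: As.2; rewrite /t1 in rs *; lra.
have u_cont : {for t1, continuous u} := is_derive_continuous (uE _ Tt1).
have : 0 <= u t1.
  rewrite leNgt; apply/negP => ut1.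
  have Tlt1 : T < t1.
    rewrite lt_neqAle Tt1 andbT; apply/eqP => E.
    by have := u_gt0 T; rewrite E in ut1 *; lra.
  have [e [e0 eP]] := near_interval (cvgr_lt _ u_cont _ ut1).
  pose r := Num.max ((T + t1) / 2) (t1 - e / 2).
  have : T < r < t1 /\ t1 - e < r.
    by rewrite /r; case: (leP ((T + t1) / 2) (t1 - e / 2)) => ?; split; lra.
  move=> [Trt er]; have := ult1 r; have := eP r; lra.
rewrite le_eqVlt => /orP[/eqP/esym ut1|ut1].
  have Tlt1 : T < t1.
    rewrite lt_neqAle Tt1 andbT; apply/eqP => E.
    by have := u_gt0 T; rewrite E in ut1 *; lra.
  have u_ge0 s : T1 <= s <= t1 -> 0 <= u s.
    move=> /andP[T1s]; rewrite le_eqVlt => /orP[/eqP->|st1]; first by rewrite ut1.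
    by apply/ltW/ult1; lra.
  have := cross _ Tt1 ut1 u_ge0; apply/negP; rewrite -leNgt.
  apply: (is_derive_le0 Tlt1 (uE _ Tt1) _ ut1) => s st; apply: u_ge0; lra.
have [e [e0 eP]] := near_interval (cvgr_gt _ u_cont _ ut1).
have : A (t1 + e / 2).
  split=> [|r rt]; first lra.
  have [rt1|t1r] := ltP r t1; first by apply: ult1; lra.
  apply: eP; lra.
move=> /(ub_le_sup supA.2); rewrite -/t1; lra.
Qed.

(** While u is nonpositive it is pushed up at a definite rate, so it becomes
positive; by the barrier principle it stays so. *)
Lemma eventually_gt0 u du (T eta : R) : 0 < eta ->
  (forall t, T <= t -> is_derive t 1 u (du t)) ->
  (forall t, T <= t -> u t <= 0 -> eta <= du t) ->
  \forall t \near +oo, 0 < u t.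
Proof.
move=> eta0 uE u_up.
have [t0 [Tt0 ut0]] : exists t0, T <= t0 /\ 0 < u t0.
  apply: contrapT => /forallNP no.
  have u_le0 t : T <= t -> u t <= 0.
    by move=> Tt; rewrite leNgt; apply/negP => ut; exact: (no t).
  (* By this time a growth of rate eta would have lifted u T above 0. *)
pose t1 := T + (`|u T| + 1) / eta.
  have uT := ler_norm (- u T); rewrite normrN in uT.
  have Tt1 : T <= t1 by rewrite lerDl divr_ge0 ?addr_ge0// ltW.
  have lin r : T <= r <= t1 -> is_derive r 1 (fun r => eta * r) eta.
    move=> _; apply: is_derive_eq; rewrite /GRing.scale/=; ring.
  have := ler_increment Tt1 lin (fun r Tr => uE r (proj1 (andP Tr))).
  have E : eta * t1 = eta * T + (`|u T| + 1) by rewrite /t1; field; rewrite gt_eqF.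
  have inc r : T <= r <= t1 -> eta <= du r.
    by move=> Tr; apply: u_up; [|apply: u_le0]; lra.
  by move=> /(_ inc); have := u_le0 t1 Tt1; lra.
apply: near_pinfty_from; exists t0.
apply: (first_crossing (T := t0) (du := du)) => //.
- by move=> t tt; have -> : t = t0 by lra.
- by move=> t t0t; apply: uE; lra.
- move=> t t0t ut _; have := u_up t; lra.
Qed.

(** Continuous induction on a bound: if every bound k below c that holds up to
a loss e improves to one with a gain e, then the supremum of the valid bounds
cannot be below c. This replaces calculations with lower and upper limits. *)
Lemma ratchet P (k0 c : R) :
  (forall k l : R, k <= l -> P l -> P k) -> P k0 ->
  (forall k : R, k0 <= k -> k < c -> exists e, 0 < e /\ (P (k - e) -> P (k + e))) ->
  forall k : R, k < c -> P k.
Proof.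
move=> P_down Pk0 step k kc.
apply: contrapT => nPk.
pose A := [set l | P l].
have Ak l : P l -> l < k.
  by move=> Pl; rewrite ltNge; apply/negP => kl; exact/nPk/(P_down k l).
have supA : has_sup A by split; [exists k0|exists k => l /Ak /ltW].
have k0s : k0 <= sup A by apply: ub_le_sup => //; exact: supA.2.
have sk : sup A <= k by apply: ge_sup; [exists k0|move=> l /Ak /ltW].
have [e [e0 eP]] := step _ k0s (le_lt_trans sk kc).
have [l Pl sl] := sup_adherent e0 supA.
have := ub_le_sup supA.2 (eP (P_down _ _ (ltW sl) Pl)); lra.
Qed.
End calculus.

(** * Limits at zero from the right *)

Section at_right0.
Context {R : realType}.
Implicit Types (P : R -> Prop) (f k df dk : R -> R).

Lemma near_at_right0P P :
  (\forall y \near 0^'+, P y) <-> exists e, 0 < e /\ forall y, 0 < y < e -> P y.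
Proof.
split=> [/nbhs_right0P H|[e [e0 eP]]].
  have [e [e0 eP]] := near_interval H.
  exists e; split=> // y /andP[y0 ye].
  by have := eP y ltac:(lra); rewrite add0r; apply.
near=> y; apply: eP.
have y0 : 0 < y by near: y; exact: nbhs_right_gt.
have ye : y < e by near: y; exact: nbhs_right_lt.
lra.
Unshelve. all: by end_near. Qed.

Lemma cvg_scale_at_right0 (l : R) : 0 < l -> l * y @[y --> 0^'+] --> 0^'+.
Proof.
move=> l0 P /near_at_right0P[e [e0 eP]]; apply/near_at_right0P.
exists (e / l); split=> [|y /andP[y0 ye]]; first exact: divr_gt0.
by apply: eP; rewrite mulr_gt0//= mulrC -ltr_pdivlMr.
Qed.

Lemma cvgr_between (T : Type) (F : set_system T) {FF : Filter F} (h : T -> R)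
    (L : R) :
  (forall c, c < L -> \forall t \near F, c <= h t) ->
  (forall c, L < c -> \forall t \near F, h t <= c) ->
  h t @[t --> F] --> L.
Proof.
move=> lo up; apply/cvgrPdist_le => e e0.
have := lo (L - e) ltac:(lra); have := up (L + e) ltac:(lra).
by apply: filterS2 => t ? ?; rewrite ler_distlC; lra.
Qed.

(** L'Hopital's rule at 0+ for a denominator that tends to infinity: the
increments of f and of k between y and a fixed y1 compare like their
derivatives, and the values at y1 are negligible. *)
Lemma lhopital_pinfty_at_right0 f k df dk (L : R) :
  (\forall y \near 0^'+, is_derive y (1 : R) f (df y)) ->
  (\forall y \near 0^'+, is_derive y (1 : R) k (dk y)) ->
  (\forall y \near 0^'+, dk y < 0) ->
  k y @[y --> 0^'+] --> +oo ->
  df y / dk y @[y --> 0^'+] --> L ->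
  f y / k y @[y --> 0^'+] --> L.
Proof.
move=> dfE dkE dk_lt0 ky dL.
apply/cvgrPdist_le => e e0.
have /cvgrPdist_le/(_ (e / 2) ltac:(lra)) dLe := dL.
have [y0 [y00 H]] := (near_at_right0P _).1
  (filterI (filterI dfE dkE) (filterI dk_lt0 dLe)).
pose y1 := y0 / 2.
(* K absorbs the contribution of the endpoint y1; it is negligible against
   k y, which tends to infinity. *)
pose K := `|f y1 - L * k y1| + e / 2 * `|k y1|.
have K0 : 0 <= K by rewrite addr_ge0// mulr_ge0//; lra.
near=> y.
have yy1 : 0 < y <= y1.
  apply/andP; split; first by near: y; exact: nbhs_right_gt.
  by near: y; apply: nbhs_right_le; rewrite /y1; lra.
have kK : 2 * K / e + 1 < k y by near: y; have /cvgryPgt := ky; exact.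
have kpos : 0 < k y by apply: le_lt_trans kK; rewrite addr_ge0// divr_ge0; lra.
have inc (c : R) r : y <= r <= y1 ->
    is_derive r 1 (fun r => c * k r) (c * dk r).
  move=> rr; have [[_ ?] _] := H r ltac:(rewrite /y1 in yy1 rr *; lra).
  by apply: is_derive_eq.
have df' r : y <= r <= y1 -> is_derive r 1 f (df r).
  by move=> rr; have [[]] := H r ltac:(rewrite /y1 in yy1 rr *; lra).
have dif r : y <= r <= y1 -> (L + e / 2) * dk r <= df r <= (L - e / 2) * dk r.
  move=> rr; have [_ []] := H r ltac:(rewrite /y1 in yy1 rr *; lra).
  move=> dkr; rewrite ler_distlC => /andP[lo up].
  have E : df r = df r / dk r * dk r by field; lra.
  by rewrite E; apply/andP; split; nra.
have yy1' : y <= y1 by lra.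
have up := ler_increment yy1' df' (inc (L - e / 2))
  (fun r rr => proj2 (andP (dif r rr))).
have lo := ler_increment yy1' (inc (L + e / 2)) df'
  (fun r rr => proj1 (andP (dif r rr))).
have E : f y / k y - L = (f y - L * k y) / k y by field; lra.
rewrite distrC E normrM normfV (gtr0_norm kpos) ler_pdivrMr//.
have n1 := ler_norm (f y1 - L * k y1); have n2 := ler_norm (- (f y1 - L * k y1)).
have n3 := ler_norm (k y1); have n4 := ler_norm (- k y1).
rewrite !normrN in n2 n4.
have Kk : K <= e / 2 * k y.
  have : e / 2 * (2 * K / e + 1) = K + e / 2 by field; lra.
  nra.
rewrite /K in Kk.
rewrite ler_norml; apply/andP; split; nra.
Unshelve. all: by end_near. Qed.
End at_right0.

Lemma ltr_ln_pos {R : realType} (x y : R) : 0 < x -> 0 < y -> (ln x < ln y) = (x < y) :> bool.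
Proof. by move=> x0 y0; rewrite ltr_ln// posrE. Qed.

(** * Regular variation at zero *)

Section regular_variation.
Context {R : realType}.
Implicit Types (g G : R -> R) (alpha l K p M : R).

Definition ndecr_right0 g := exists e, 0 < e /\
  forall y w, 0 < y <= w -> w < e -> g y <= g w.

Lemma RV0_scale_lt g alpha l K : RV0 g alpha -> 0 < l -> l `^ alpha < K ->
  \forall y \near 0^'+, g (l * y) < K * g y.
Proof.
move=> [g_gt0 gl] l0 lK.
apply: filterS2 g_gt0 (cvgr_lt _ (gl l l0) _ lK) => y gy.
by rewrite ltr_pdivrMr.
Qed.

Lemma RV0_scale_gt g alpha l K : RV0 g alpha -> 0 < l -> K < l `^ alpha ->
  \forall y \near 0^'+, K * g y < g (l * y).
Proof.
move=> [g_gt0 gl] l0 lK.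
apply: filterS2 g_gt0 (cvgr_gt _ (gl l l0) _ lK) => y gy.
by rewrite ltr_pdivlMr.
Qed.

Lemma RV0_le_scale g alpha l K : RV0 g alpha -> ndecr_right0 g -> 0 < l ->
  l `^ alpha < K ->
  exists e, 0 < e /\
    forall y w, 0 < y < e -> 0 < w <= l * y -> g w <= K * g y.
Proof.
move=> gRV [d [d0 g_incr]] l0 /(RV0_scale_lt gRV l0) gs.
have : \forall y \near 0^'+, l * y < d.
  exact: (cvg_scale_at_right0 l0 (nbhs_right_lt d0)).
move=> /(filterI gs) gs'; have [e [e0 eP]] := (near_at_right0P _).1 gs'.
exists e; split=> // y w ye wy.
have [gy lyd] := eP y ye.
by apply: le_trans _ (ltW gy); exact: g_incr.
Qed.

Lemma RV0_ge_scale g alpha l K : RV0 g alpha -> ndecr_right0 g -> 0 < l ->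
  K < l `^ alpha ->
  exists e, 0 < e /\
    forall y w, 0 < y < e -> l * y <= w < e -> K * g y <= g w.
Proof.
move=> gRV [d [d0 g_incr]] l0 /(RV0_scale_gt gRV l0).
move=> /near_at_right0P[e [e0 eP]].
exists (Num.min d e); split=> [|y w]; first by rewrite lt_min d0.
rewrite !lt_min => /and3P[y0 yd ye] /and3P[lyw wd we].
have gw : g (l * y) <= g w by apply: g_incr => //; rewrite lyw mulr_gt0.
by apply: le_trans gw; apply/ltW/eP; rewrite y0.
Qed.

(** L'Hopital's rule for g (l y) / g y, both terms vanishing at 0: the quotient
of the derivatives tends to l * l ^ (alpha - 1). *)
Lemma RV0_of_derive g alpha (d : R) : 0 < d ->
  (forall y, 0 < y < d -> derivable g y 1) ->
  (forall y, 0 < y < d -> 0 < derive1 g y) ->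
  (forall y, 0 < y -> 0 < g y) ->
  g y @[y --> 0^'+] --> 0 ->
  RV0 (derive1 g) (alpha - 1) -> RV0 g alpha.
Proof.
move=> d0 g_der g'_gt0 g_gt0 g0 [_ g'RV]; split.
  by near=> y; apply: g_gt0; near: y; exact: nbhs_right_gt.
move=> l l0.
pose b := Num.min d (d / l).
have b0 : 0 < b by rewrite lt_min d0 divr_gt0.
have bd y : y \in `]0, b[ -> (0 < y < d) && (0 < l * y < d).
  rewrite in_itv/= lt_min ltr_pdivlMr// => /and3P[y0 -> yl].
  by rewrite y0 mulr_gt0//= mulrC.
have gE y : 0 < y < d -> is_derive y 1 g (derive1 g y).
  by move=> yd; rewrite derive1E; exact/derivableP/g_der.
apply: (@lhopital_at_right R (fun y => g (l * y))
  (fun y => l * derive1 g (l * y)) g (derive1 g) 0 b) => //.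
- move=> y /bd/andP[yd lyd].
  have ? := gE _ lyd.
  have ? : is_derive y 1 (fun y => l * y) l.
    by apply: is_derive_eq; rewrite /GRing.scale/= mulr1.
  by rewrite mulrC; exact: (@is_derive1_comp R g (fun y => l * y)).
- by move=> y /bd/andP[yd lyd]; exact: gE.
- exact: (cvg_comp _ _ (cvg_scale_at_right0 l0) g0).
- by move=> y /bd/andP[yd _]; rewrite gt_eqF// g'_gt0.
- have -> : l `^ alpha = l * l `^ (alpha - 1).
    rewrite -{2}(powRr1 (ltW l0)) -powRD; last by rewrite (gt_eqF l0) implybT.
    by congr (_ `^ _); ring.
  under eq_fun do rewrite -mulrA.
  by apply: cvgM; [exact: cvg_cst|exact: g'RV].
Unshelve. all: by end_near. Qed.

(** Every point of (0, y0] reaches the dyadic block [y0 / 2, y0] by finitely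
many doublings. *)
Lemma dyadic_ind (P : R -> Prop) (y0 : R) : 0 < y0 ->
  (forall y, y0 / 2 <= y <= y0 -> P y) ->
  (forall y, 0 < y <= y0 / 2 -> P (2 * y) -> P y) ->
  forall y, 0 < y <= y0 -> P y.
Proof.
move=> y00 base step.
have H n : forall y, 0 < y <= y0 -> y0 / 2 <= 2 ^+ n * y -> P y.
  elim: n => [|n IH] y yy0; first by rewrite expr0 mul1r => ?; apply: base; lra.
  rewrite exprSr -mulrA => ny.
  have [y2|y2] := leP y (y0 / 2); last by apply: base; lra.
  by apply: step; [lra|apply: IH => //; lra].
move=> y yy0; have y_gt0 : 0 < y by lra.
have := archi_boundP (ltW (divr_gt0 y00 y_gt0)).
set n := Num.bound _; rewrite ltr_pdivrMr// => yn.
apply: (H n) => //; apply: (@le_trans _ _ (n%:R * y)); first lra.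
by rewrite ler_pM2r// -natrX ler_nat ltnW// ltn_expl.
Qed.

(** A Potter type bound. Halving the argument multiplies g by more than 2 ^ - p
near 0, so the bound g y >= c y ^ p propagates from one dyadic block to the next. *)
Lemma RV0_ge_powR g alpha p : RV0 g alpha -> ndecr_right0 g -> 0 <= p -> alpha < p ->
  exists c, 0 < c /\ \forall y \near 0^'+, c * y `^ p <= g y.
Proof.
move=> gRV [d [d0 g_incr]] p0 ap.
have h0 : (0 : R) < 2^-1 by rewrite invr_gt0.
have hp : 2^-1 `^ p < 2^-1 `^ alpha :> R.
  rewrite -ltr_ln_pos ?powR_gt0// !ln_powR lnV ?posrE//.
  have := @ln_gt0 R 2 ltac:(lra); nra.
have gs := RV0_scale_gt gRV h0 hp.
have [e [e0 eP]] := (near_at_right0P _).1 (filterI gRV.1 gs).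
pose y0 := Num.min d e / 2.
have y0P : [/\ 0 < y0, y0 < d & y0 < e].
  by rewrite /y0; case: (leP d e) => ?; split; lra.
have [y00 y0d y0e] := y0P.
have gy0 : 0 < g (y0 / 2) by apply: (eP _ _).1; lra.
pose c := g (y0 / 2) / y0 `^ p.
have c0 : 0 < c by rewrite divr_gt0// powR_gt0.
exists c; split=> //.
apply/near_at_right0P; exists y0; split=> // y yy0.
have : 0 < y <= y0 by lra.
move: y {yy0}; apply: dyadic_ind => // y yy0.
  apply: (@le_trans _ _ (c * y0 `^ p)).
    by rewrite ler_pM2l// ge0_ler_powR// ?nnegrE; lra.
  rewrite /c divfK ?gt_eqF ?powR_gt0//; apply: g_incr; lra.
move=> IH; have [g2y] := eP (2 * y) ltac:(lra).
rewrite mulrA mulVf ?mul1r ?pnatr_eq0// => /ltW; apply: le_trans.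
have -> : c * y `^ p = 2^-1 `^ p * (c * (2 * y) `^ p).
  rewrite powRM//; try lra.
  rewrite mulrCA; congr (_ * _); rewrite mulrA -powRM//; try lra.
  by rewrite mulVf ?powR1 ?mul1r// pnatr_eq0.
by rewrite ler_pM2l// powR_gt0.
Qed.

(** The dual dyadic argument with exponent 1; it is what makes the primitive of
1 / g diverge at 0. *)
Lemma RV0_le_linear g alpha : RV0 g alpha -> ndecr_right0 g -> 1 < alpha ->
  exists C, 0 < C /\ \forall y \near 0^'+, g y <= C * y.
Proof.
move=> gRV [d [d0 g_incr]] a1.
have h0 : (0 : R) < 2^-1 by rewrite invr_gt0.
have hp : 2^-1 `^ alpha < 2^-1 :> R.
  rewrite -ltr_ln_pos ?powR_gt0// !ln_powR lnV ?posrE//.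
  have := @ln_gt0 R 2 ltac:(lra); nra.
have gs := RV0_scale_lt gRV h0 hp.
have [e [e0 eP]] := (near_at_right0P _).1 (filterI gRV.1 gs).
pose y0 := Num.min d e / 2.
have y0P : [/\ 0 < y0, y0 < d & y0 < e].
  by rewrite /y0; case: (leP d e) => ?; split; lra.
have [y00 y0d y0e] := y0P.
have gy0 : 0 < g y0 by apply: (eP _ _).1; lra.
pose C := g y0 / (y0 / 2).
have C0 : 0 < C by rewrite divr_gt0//; lra.
exists C; split=> //.
apply/near_at_right0P; exists y0; split=> // y yy0.
have : 0 < y <= y0 by lra.
move: y {yy0}; apply: dyadic_ind => // y yy0.
  apply: (@le_trans _ _ (C * (y0 / 2))); last by rewrite ler_pM2l//; lra.
  rewrite /C divfK; last by rewrite gt_eqF//; lra.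
  by apply: g_incr; lra.
move=> IH; have [g2y] := eP (2 * y) ltac:(lra).
rewrite mulrA mulVf ?mul1r ?pnatr_eq0//; lra.
Qed.

Section primitive.
Variables (g G : R -> R) (beta : R).
Hypotheses (beta_gt1 : 1 < beta) (gRV : RV0 g beta) (g_incr : ndecr_right0 g).
Hypothesis GE : \forall y \near 0^'+, is_derive y (1 : R) G (- (g y)^-1).

Lemma primitive_pinfty : G y @[y --> 0^'+] --> +oo.
Proof.
have [C [C0 gC]] := RV0_le_linear gRV g_incr beta_gt1.
have [e [e0 eP]] := (near_at_right0P _).1 (filterI GE (filterI gRV.1 gC)).
pose y0 := e / 2.
apply/cvgryPge => A.
near=> y.
have yy0 : 0 < y <= y0.
  apply/andP; split; first by near: y; exact: nbhs_right_gt.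
  by near: y; apply: nbhs_right_le; rewrite /y0; lra.
have lny : ln y <= - (C * (A - G y0)) + ln y0.
  by near: y; have /cvgrNyPle := @lnNy R; exact.
have kE r : y <= r <= y0 -> is_derive r 1 (fun r => - C^-1 * ln r) (- C^-1 * r^-1).
  move=> rr; have ? := @is_derive1_ln R r ltac:(lra).
  by apply: is_derive_eq.
have GE' r : y <= r <= y0 -> is_derive r 1 G (- (g r)^-1).
  by move=> rr; have [] := eP r ltac:(rewrite /y0 in yy0 rr *; lra).
have cmp r : y <= r <= y0 -> - (g r)^-1 <= - C^-1 * r^-1.
  move=> rr; have [_ [gr0 grC]] := eP r ltac:(rewrite /y0 in yy0 rr *; lra).
  rewrite mulNr lerN2 -invfM lef_pV2// posrE//; apply: mulr_gt0; lra.
have yy0' : y <= y0 by lra.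
have := ler_increment yy0' GE' kE cmp.
have : C^-1 * (ln y0 - ln y) >= C^-1 * (C * (A - G y0)).
  by rewrite ler_pM2l ?invr_gt0//; lra.
rewrite mulrA mulVf ?gt_eqF// mul1r; lra.
Unshelve. all: by end_near. Qed.

(** The derivatives of G (l y) and of G y have quotient l g y / g (l y), which
tends to l ^ (1 - beta). *)
Lemma RV0_primitive : RV0 G (1 - beta).
Proof.
split; first by have /cvgryPgt := primitive_pinfty; exact.
move=> l l0.
apply: (@lhopital_pinfty_at_right0 R (fun y => G (l * y)) G
  (fun y => l * - (g (l * y))^-1) (fun y => - (g y)^-1)) => //.
- have GE' : \forall y \near 0^'+, is_derive (l * y) (1 : R) G (- (g (l * y))^-1).
    exact: (cvg_scale_at_right0 l0 GE).
  apply: filterS GE' => y ?.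
  have ? : is_derive y 1 (fun y => l * y) l.
    by apply: is_derive_eq; rewrite /GRing.scale/= mulr1.
  by rewrite mulrC; exact: (@is_derive1_comp R G (fun y => l * y)).
- by apply: filterS gRV.1 => y gy; rewrite oppr_lt0 invr_gt0.
- exact: primitive_pinfty.
- have -> : l `^ (1 - beta) = l * (l `^ beta)^-1.
    by rewrite powRD ?(gt_eqF l0) ?implybT// powRr1 ?powRN// ltW.
  have lb0 : l `^ beta != 0 by rewrite gt_eqF// powR_gt0.
  have H : (fun y => l * (g (l * y) / g y)^-1) y @[y --> 0^'+] -->
      l * (l `^ beta)^-1.
    by apply: cvgM; [exact: cvg_cst|apply: cvgV => //; exact: gRV.2].
  apply: cvg_trans H; apply: near_eq_cvg; near=> y.
  have gy : 0 < g y by near: y; exact: gRV.1.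
  have gly : 0 < g (l * y) by near: y; exact: (cvg_scale_at_right0 l0 gRV.1).
  by rewrite /=; field; rewrite !gt_eqF.
Unshelve. all: by end_near. Qed.

Lemma primitive_decr : exists e, 0 < e /\
  forall y w, 0 < y < w -> w < e -> G w < G y.
Proof.
have [e [e0 eP]] := (near_at_right0P _).1 (filterI GE gRV.1).
exists e; split=> // y w yw we.
have GE' r : y <= r <= w -> is_derive r 1 G (- (g r)^-1).
  by move=> rr; have [] := eP r ltac:(lra).
have yw' : y < w by lra.
have [c cyw E] := MVT yw'
  (fun r rr => GE' r ltac:(move: rr; rewrite in_itv/=; lra))
  (is_derive_segment_continuous GE').
move: cyw; rewrite in_itv/= => cyw.
have [_ gc] := eP c ltac:(lra).
have : 0 < (g c)^-1 by rewrite invr_gt0.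
nra.
Qed.

Let theta := beta / (beta - 1).

(** Regular variation, of index - theta, of g as a function of the value of G:
the equation for G (x t) involves g only through quotients of such values.
This lemma and the next one give the two one-sided estimates. *)
Lemma primitive_compose_le p M : 0 < p -> p `^ (- theta) < M ->
  exists e, 0 < e /\ forall y w, 0 < y < e -> 0 < w < e ->
    p * G y <= G w -> g w <= M * g y.
Proof.
move=> p0 pM.
have pt0 : 0 < p `^ (- theta) by exact: powR_gt0.
pose M' := (p `^ (- theta) + M) / 2.
have M'0 : 0 < M' by rewrite /M'; lra.
(* l is the scale at which g grows by the factor M'; the inequality between
   M' and p ^ (- theta) says exactly that scaling by l takes G past p G. *)
pose l := M' `^ beta^-1.
have l0 : 0 < l by exact: powR_gt0.
have bne : beta != 0 by rewrite gt_eqF ?(lt_trans ltr01 beta_gt1).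
have lb : l `^ beta = M'.
  by rewrite /l -powRrM (mulVf bne) (powRr1 (ltW M'0)).
have lp : l `^ (1 - beta) < p.
  rewrite -ltr_ln_pos ?powR_gt0// !ln_powR.
  have H : ln (p `^ (- theta)) < ln M' by rewrite ltr_ln_pos// /M'; lra.
  rewrite ln_powR in H.
  have -> : ln p = (1 - beta) * (beta^-1 * (- theta * ln p)).
    by rewrite /theta; field; rewrite bne subr_eq0 gt_eqF.
  rewrite ltr_nM2l ?subr_lt0//.
  by rewrite ltr_pM2l// invr_gt0 (lt_trans ltr01).
have [e1 [e10 H1]] := (near_at_right0P _).1 (RV0_scale_lt RV0_primitive l0 lp).
have [e2 [e20 H2]] := primitive_decr.
have lM : l `^ beta < M by rewrite lb /M'; lra.
have [e3 [e30 H3]] := RV0_le_scale gRV g_incr l0 lM.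
exists (Num.min e1 (Num.min e2 e3)); split; first by rewrite !lt_min e10 e20.
move=> y w; rewrite !lt_min => /and4P[y0 y1 y2 y3] /and4P[w0 w1 w2 w3] Gyw.
apply: H3; first by rewrite y0.
rewrite w0/= leNgt; apply/negP => wl.
have := H1 y ltac:(by rewrite y0); have := H2 (l * y) w.
rewrite wl mulr_gt0// => /(_ isT w2); lra.
Qed.

Lemma primitive_compose_ge p M : 0 < p -> 0 < M -> M < p `^ (- theta) ->
  exists e, 0 < e /\ forall y w, 0 < y < e -> 0 < w < e ->
    G w <= p * G y -> M * g y <= g w.
Proof.
move=> p0 M0 pM.
pose M' := (p `^ (- theta) + M) / 2.
have M'0 : 0 < M' by rewrite /M'; lra.
pose l := M' `^ beta^-1.
have l0 : 0 < l by exact: powR_gt0.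
have bne : beta != 0 by rewrite gt_eqF ?(lt_trans ltr01 beta_gt1).
have lb : l `^ beta = M'.
  by rewrite /l -powRrM (mulVf bne) (powRr1 (ltW M'0)).
have lp : p < l `^ (1 - beta).
  rewrite -ltr_ln_pos ?powR_gt0// !ln_powR.
  have H : ln M' < ln (p `^ (- theta)).
    by rewrite ltr_ln_pos ?powR_gt0// /M'; lra.
  rewrite ln_powR in H.
  have -> : ln p = (1 - beta) * (beta^-1 * (- theta * ln p)).
    by rewrite /theta; field; rewrite bne subr_eq0 gt_eqF.
  rewrite ltr_nM2l ?subr_lt0//.
  by rewrite ltr_pM2l// invr_gt0 (lt_trans ltr01).
have [e1 [e10 H1]] := (near_at_right0P _).1 (RV0_scale_gt RV0_primitive l0 lp).
have [e2 [e20 H2]] := primitive_decr.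
have lM : M < l `^ beta by rewrite lb /M'; lra.
have [e3 [e30 H3]] := RV0_ge_scale gRV g_incr l0 lM.
have [e4 [e40 H4]] : exists e4, 0 < e4 /\ l * e4 = e2.
  by exists (e2 / l); rewrite divr_gt0//; split=> //; field; rewrite gt_eqF.
exists (Num.min (Num.min e1 e4) (Num.min e2 e3)).
split; first by rewrite !lt_min e10 e20 e40.
move=> y w; rewrite !lt_min => /andP[y0 /andP[/andP[y1 y4] /andP[y2 y3]]].
move=> /andP[w0 /andP[/andP[w1 w4] /andP[w2 w3]]] Gyw.
apply: H3; first by rewrite y0.
rewrite w3 andbT leNgt; apply/negP => wl.
have := H1 y ltac:(by rewrite y0); have := H2 w (l * y).
have lye : l * y < e2 by rewrite -H4 ltr_pM2l.
rewrite wl w0 => /(_ isT lye); lra.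
Qed.

(** Inversion of the regularly varying G: comparing G (x t) with G (l y t) for
each fixed l decides whether x t exceeds l y t. *)
Lemma primitive_inv_asymp (T : Type) (F : set_system T) {FF : Filter F}
    (x y : T -> R) (c : R) :
  0 < c -> (\forall t \near F, 0 < x t) -> (\forall t \near F, 0 < y t) ->
  x t @[t --> F] --> 0 -> y t @[t --> F] --> 0 ->
  G (x t) / G (y t) @[t --> F] --> c ->
  x t / y t @[t --> F] --> c `^ (- (beta - 1)^-1).
Proof.
move=> c0 x_gt0 y_gt0 x0 y0 xyc.
have to0 (h : T -> R) P : (\forall t \near F, 0 < h t) -> h t @[t --> F] --> 0 ->
    (\forall u \near 0^'+, P u) -> \forall t \near F, P (h t).
  move=> h_gt0 h0 /near_at_right0P[e [e0 eP]].
  apply: filterS2 h_gt0 (cvgr_lt _ h0 _ e0) => t ht hte.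
  by apply: eP; rewrite ht.
have [e [e0 Gdecr]] := primitive_decr.
have powE l : 0 < l -> ln (l `^ (1 - beta)) - ln c =
    (1 - beta) * (ln l - ln (c `^ (- (beta - 1)^-1))).
  by move=> l0; rewrite !ln_powR; field; rewrite subr_eq0 gt_eqF.
have small l : 0 < l -> \forall t \near F, [/\ 0 < x t, 0 < y t, 0 < G (y t),
    x t < e & l * y t < e].
  move=> l0.
  have lye : \forall u \near 0^'+, l * u < e.
    exact: (cvg_scale_at_right0 l0 (nbhs_right_lt e0)).
  have Hy := to0 y _ y_gt0 y0 (filterI RV0_primitive.1 lye).
  have Hx := to0 x _ x_gt0 x0 (nbhs_right_lt e0).
  near=> t.
  have [Gy ly] : (0 < G (y t)) /\ l * y t < e by near: t; exact: Hy.
  by split=> //; near: t.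
apply: cvgr_between => l.
  have [l0 _|l0 lc] := leP l 0.
    by apply: filterS2 x_gt0 y_gt0 => t xt yt; rewrite (le_trans l0)// ltW// divr_gt0.
  have cl : c < l `^ (1 - beta).
    rewrite -ltr_ln_pos ?powR_gt0// -subr_gt0 powE//.
    rewrite -ltr_ln_pos ?powR_gt0// in lc.
    by rewrite nmulr_rgt0 ?subr_lt0.
  pose c' := (c + l `^ (1 - beta)) / 2.
  have H1 := to0 y _ y_gt0 y0
    (RV0_scale_gt RV0_primitive l0 (ltac:(rewrite /c'; lra) : c' < l `^ (1 - beta))).
  have H2 := cvgr_lt _ xyc _ (ltac:(rewrite /c'; lra) : c < c').
  apply: filterS3 H1 H2 (small l l0) => t H1 H2 [xt yt Gy xe lye].
  rewrite ler_pdivlMr// leNgt; apply/negP => xl.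
  have := Gdecr (x t) (l * y t) ltac:(by rewrite xt) lye.
  by move: H2; rewrite ltr_pdivrMr//; lra.
move=> lc.
have l0 : 0 < l by apply: le_lt_trans lc; exact: powR_ge0.
have cl : l `^ (1 - beta) < c.
  rewrite -ltr_ln_pos ?powR_gt0// -subr_lt0 powE//.
  rewrite -ltr_ln_pos ?powR_gt0// in lc.
  by rewrite nmulr_rlt0 ?subr_lt0 ?subr_gt0.
pose c' := (c + l `^ (1 - beta)) / 2.
have H1 := to0 y _ y_gt0 y0
  (RV0_scale_lt RV0_primitive l0 (ltac:(rewrite /c'; lra) : l `^ (1 - beta) < c')).
have H2 := cvgr_gt _ xyc _ (ltac:(rewrite /c'; lra) : c' < c).
apply: filterS3 H1 H2 (small l l0) => t H1 H2 [xt yt Gy xe lye].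
rewrite ler_pdivrMr// leNgt; apply/negP => xl.
have := Gdecr (l * y t) (x t) ltac:(by rewrite xl mulr_gt0) xe.
by move: H2; rewrite ltr_pdivlMr//; lra.
Unshelve. all: by end_near. Qed.
End primitive.
End regular_variation.

(** * Linear growth of the transformed solution *)

Section linear_growth.
Context {R : realType}.
Variables (z r d : R -> R) (a b p theta : R).
Hypotheses (b_gt0 : 0 < b) (theta_gt0 : 0 < theta) (p_gt0 : 0 < p).
Let c := a - b * p `^ (- theta).
Hypothesis c_gt0 : 0 < c.
Hypothesis zE : \forall t \near +oo, is_derive t (1 : R) z (a - b * r t).
Hypothesis r_ge0 : \forall t \near +oo, 0 <= r t.
Hypothesis z_ge1 : \forall t \near +oo, 1 <= z t.
Hypothesis r_le : forall rho M : R, 0 < rho -> rho `^ (- theta) < M ->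
  \forall t \near +oo, rho * z t <= z (d t) -> r t <= M.
Hypothesis r_ge : forall rho M : R, 0 < rho -> 0 < M -> M < rho `^ (- theta) ->
  \forall t \near +oo, z (d t) <= rho * z t -> M <= r t.
Hypothesis d_le : \forall t \near +oo, d t <= t.
Hypothesis dy : d t @[t --> +oo] --> +oo.
Hypothesis dp : d t / t @[t --> +oo] --> p.

(** A strict inequality at p leaves room for a slightly smaller ratio rho; the
next lemma does the same on the other side. *)
Lemma powRN_slack_left M : p `^ (- theta) < M ->
  exists rho, 0 < rho < p /\ rho `^ (- theta) < M.
Proof.
move=> pM; pose M' := (p `^ (- theta) + M) / 2.
have pt0 : 0 < p `^ (- theta) by exact: powR_gt0.
have M'0 : 0 < M' by rewrite /M'; lra.
exists (M' `^ (- theta^-1)).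
rewrite -powRrM mulrNN mulVf ?gt_eqF// powRr1 ?ltW// powR_gt0//=.
split; last by rewrite /M'; lra.
rewrite -ltr_ln_pos ?powR_gt0//; rewrite ln_powR.
have H : ln (p `^ (- theta)) < ln M' by rewrite ltr_ln_pos// /M'; lra.
rewrite ln_powR in H.
have -> : ln p = - theta^-1 * (- theta * ln p) by field; rewrite gt_eqF.
by rewrite ltr_nM2l// oppr_lt0 invr_gt0.
Qed.

Lemma powRN_slack_right M : 0 < M -> M < p `^ (- theta) ->
  exists rho, p < rho /\ M < rho `^ (- theta).
Proof.
move=> M0 pM; pose M' := (p `^ (- theta) + M) / 2.
have M'0 : 0 < M' by rewrite /M'; lra.
exists (M' `^ (- theta^-1)).
rewrite -powRrM mulrNN mulVf ?gt_eqF// powRr1 ?ltW//.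
split; last by rewrite /M'; lra.
rewrite -ltr_ln_pos ?powR_gt0//; rewrite ln_powR.
have H : ln M' < ln (p `^ (- theta)).
  by rewrite ltr_ln_pos ?powR_gt0// /M'; lra.
rewrite ln_powR in H.
have -> : ln p = - theta^-1 * (- theta * ln p) by field; rewrite gt_eqF.
by rewrite ltr_nM2l// oppr_lt0 invr_gt0.
Qed.

Lemma delay_ge p' : p' < p -> \forall t \near +oo, p' * t <= d t.
Proof.
move=> pp'; apply: filterS2 (cvgr_ge _ dp _ pp') (nbhs_pinfty_gt (num_real 0)).
by move=> t + t0; rewrite ler_pdivlMr.
Qed.

Lemma delay_le p' : p < p' -> \forall t \near +oo, d t <= p' * t.
Proof.
move=> pp'; apply: filterS2 (cvgr_le _ dp _ pp') (nbhs_pinfty_gt (num_real 0)).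
by move=> t + t0; rewrite ler_pdivrMr.
Qed.

Lemma is_derive_subl (k t : R) : is_derive t 1 z (a - b * r t) ->
  is_derive t 1 (fun s => z s - k * s) (a - b * r t - k).
Proof.
move=> ?; have ? : is_derive t 1 (fun s => k * s) k.
  by apply: is_derive_eq; rewrite /GRing.scale/= mulr1.
exact: is_deriveB.
Qed.

Lemma is_derive_lsub (k t : R) : is_derive t 1 z (a - b * r t) ->
  is_derive t 1 (fun s => k * s - z s) (k - (a - b * r t)).
Proof.
move=> ?; have ? : is_derive t 1 (fun s => k * s) k.
  by apply: is_derive_eq; rewrite /GRing.scale/= mulr1.
exact: is_deriveB.
Qed.

(** A line of small slope k through the origin is a barrier: where z first
touches it, the past of z lies above it, so z (d t) / z t >= d t / t, which is
nearly p, and z grows at a rate close to c > k. *)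
Lemma linear_lower_bound : exists k, 0 < k /\ \forall t \near +oo, k * t <= z t.
Proof.
have b0 := b_gt0; have p0 := p_gt0.
have [q aE] : exists q, a = b * q by exists (a / b); field; rewrite gt_eqF.
have pM : p `^ (- theta) < q by rewrite -(ltr_pM2l b_gt0) -aE -subr_gt0.
pose M := (p `^ (- theta) + q) / 2.
have aM : 0 < a - b * M by rewrite aE -mulrBr mulr_gt0// /M; lra.
have [rho [rhop rhoM]] := powRN_slack_left (ltac:(rewrite /M; lra) : p `^ (- theta) < M).
have rho0 : 0 < rho by lra.
have [T1 [T10 H1]] := near_pinftyW z_ge1.
have [T [T0 H]] := near_pinftyW (filterI (filterI zE (r_le rho0 rhoM))
  (filterI (filterI d_le (cvgry_gt dy T1)) (filterI (delay_ge (proj2 (andP rhop)))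
   (nbhs_pinfty_gt (num_real T1))))).
have TT1 : T1 < T by have [_ [_ []]] := H T (lexx _).
have T_inv : 0 < T^-1 by rewrite invr_gt0.
(* On [T1, T] the bound z >= 1 > k T suffices; after T the slope a - b M
   exceeds k. *)
pose k := Num.min (T^-1 / 2) ((a - b * M) / 2).
have [k0 kT kaM] : [/\ 0 < k, k < T^-1 & k < a - b * M].
  by rewrite /k; case: (leP (T^-1 / 2) ((a - b * M) / 2)) => ?; split; lra.
exists k; split=> //.
apply: near_pinfty_from; exists T1 => t T1t.
rewrite -subr_ge0; apply/ltW; move: t T1t.
apply: (first_crossing (T := T) (du := fun t => a - b * r t - k)).
- move=> t T1t; have := H1 t ltac:(lra).
  have : k * T < T^-1 * T by rewrite ltr_pM2r.
  rewrite mulVf ?gt_eqF//; nra.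
- lra.
- by move=> t Tt; apply: is_derive_subl; have [[]] := H t Tt.
- move=> t Tt zt hist.
  have [[_ rM] [[dt T1d] [rd _]]] := H t Tt.
  have := hist (d t) ltac:(lra) => zd.
  have krd : k * (rho * t) <= k * d t by rewrite ler_pM2l.
  have ztE : z t = k * t by lra.
  have : b * r t <= b * M by rewrite ler_pM2l// rM// ztE; lra.
  lra.
Qed.

(** If z is eventually above (k - e) t, then wherever z <= (k + e) t the ratio
z (d t) / z t exceeds nearly p (k - e) / (k + e), so that z grows at a rate
still larger than k + e. *)
Lemma lower_step (k : R) : 0 < k -> k < c -> exists e, 0 < e /\
  ((\forall t \near +oo, (k - e) * t <= z t) ->
   \forall t \near +oo, (k + e) * t <= z t).
Proof.
have b0 := b_gt0; have p0 := p_gt0.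
move=> k0 kc; rewrite /c in kc.
have [q aE] : exists q, a - k = b * q.
  by exists ((a - k) / b); field; rewrite gt_eqF.
have pM : p `^ (- theta) < q by rewrite -(ltr_pM2l b_gt0) -aE; lra.
pose M := (p `^ (- theta) + q) / 2.
have aM : k < a - b * M.
  have : b * M < b * q by rewrite ltr_pM2l// /M; lra.
  lra.
have [rho [rhop rhoM]] := powRN_slack_left (ltac:(rewrite /M; lra) : p `^ (- theta) < M).
have rho0 : 0 < rho by lra.
pose p' := (rho + p) / 2.
(* e1 solves rho (k + e1) = (k - e1) p'. *)
pose e1 := k * (p' - rho) / (p' + rho).
have pp' : 0 < p' + rho by rewrite /p'; lra.
have e1E : e1 * (p' + rho) = k * (p' - rho) by rewrite /e1; field; rewrite gt_eqF.
have e10 : 0 < e1.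
  by rewrite divr_gt0// mulr_gt0// /p'; lra.
pose e := Num.min e1 ((a - b * M - k) / 2).
have [e0 ee1 eaM] : [/\ 0 < e, e <= e1 & e < a - b * M - k].
  by rewrite /e; case: (leP e1 ((a - b * M - k) / 2)) => ?; split; lra.
have ek : e < k by rewrite /p' in e1E pp' *; nra.
exists e; split=> // zk.
have [T [T0 H]] := near_pinftyW (filterI (filterI zE (r_le rho0 rhoM))
  (filterI (near_pinfty_after dy zk)
    (delay_ge (ltac:(rewrite /p'; lra) : p' < p)))).
have := @eventually_gt0 _ (fun t => z t - (k + e) * t)
   (fun t => a - b * r t - (k + e)) T (a - b * M - k - e) ltac:(lra).
move=> /(_ (fun t Tt => is_derive_subl _ (proj1 (proj1 (H t Tt))))) up.
apply: filterS (up _) => [t|t Tt zt]; first by rewrite subr_gt0 => /ltW.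
have [[_ rM] [zd pd]] := H t Tt.
have := zd (d t) (lexx _) => zdt.
have t0 : 0 < t by lra.
have : b * r t <= b * M.
  rewrite ler_pM2l//; apply: rM.
  have h1 : rho * z t <= rho * ((k + e) * t) by rewrite ler_pM2l//; lra.
  have h2 : (k - e) * (p' * t) <= (k - e) * d t by rewrite ler_pM2l//; lra.
  have h3 : rho * (k + e) <= (k - e) * p' by nra.
  have h4 : rho * (k + e) * t <= (k - e) * p' * t by rewrite ler_pM2r.
  lra.
lra.
Qed.

(** The mirror image of the preceding step. *)
Lemma upper_step (k : R) : c < k -> exists e, 0 < e /\
  ((\forall t \near +oo, z t <= (k + e) * t) ->
   \forall t \near +oo, z t <= (k - e) * t).
Proof.
have b0 := b_gt0; have p0 := p_gt0.
move=> kc; have := c_gt0; rewrite /c => c_gt0'; rewrite /c in kc.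
have k0 : 0 < k by lra.
have pt0 : 0 < p `^ (- theta) by exact: powR_gt0.
have [q aE] : exists q, a - k = b * q.
  by exists ((a - k) / b); field; rewrite gt_eqF.
have pM : q < p `^ (- theta) by rewrite -(ltr_pM2l b_gt0) -aE; lra.
pose M := (p `^ (- theta) + Num.max 0 q) / 2.
have [M0 Mp kM] : [/\ 0 < M, M < p `^ (- theta) & q < M].
  by rewrite /M; case: (leP 0 q) => ?; split; lra.
have aM : a - b * M < k.
  have : b * q < b * M by rewrite ltr_pM2l.
  lra.
have [rho [rhop rhoM]] := powRN_slack_right M0 Mp.
have rho0 : 0 < rho by lra.
pose p' := (rho + p) / 2.
(* e1 solves rho (k - e1) = (k + e1) p'. *)
pose e1 := k * (rho - p') / (p' + rho).
have pp' : 0 < p' + rho by rewrite /p'; lra.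
have e1E : e1 * (p' + rho) = k * (rho - p') by rewrite /e1; field; rewrite gt_eqF.
have e10 : 0 < e1.
  by rewrite divr_gt0// mulr_gt0// /p'; lra.
pose e := Num.min e1 ((k - (a - b * M)) / 2).
have [e0 ee1 eaM] : [/\ 0 < e, e <= e1 & e < k - (a - b * M)].
  by rewrite /e; case: (leP e1 ((k - (a - b * M)) / 2)) => ?; split; lra.
have ek : e < k by rewrite /p' in e1E pp' *; nra.
exists e; split=> // zk.
have [T [T0 H]] := near_pinftyW (filterI (filterI zE (r_ge rho0 M0 rhoM))
  (filterI (near_pinfty_after dy zk)
    (delay_le (ltac:(rewrite /p'; lra) : p < p')))).
have := @eventually_gt0 _ (fun t => (k - e) * t - z t)
   (fun t => (k - e) - (a - b * r t)) T (k - e - (a - b * M)) ltac:(lra).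
move=> /(_ (fun t Tt => is_derive_lsub _ (proj1 (proj1 (H t Tt))))) up.
apply: filterS (up _) => [t|t Tt zt]; first by rewrite subr_gt0 => /ltW.
have [[_ rM] [zd pd]] := H t Tt.
have := zd (d t) (lexx _) => zdt.
have t0 : 0 < t by lra.
have : b * M <= b * r t.
  rewrite ler_pM2l//; apply: rM.
  have h1 : rho * ((k - e) * t) <= rho * z t by rewrite ler_pM2l//; lra.
  have h2 : (k + e) * d t <= (k + e) * (p' * t) by rewrite ler_pM2l//; lra.
  have h3 : (k + e) * p' <= rho * (k - e) by nra.
  have h4 : (k + e) * p' * t <= rho * (k - e) * t by rewrite ler_pM2r.
  lra.
lra.
Qed.

(** The delayed term only slows z down, so its slope is at most a. *)
Lemma linear_upper_bound : \forall t \near +oo, z t <= (a + 1) * t.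
Proof.
have b0 := b_gt0.
have [T [T0 H]] := near_pinftyW (filterI zE r_ge0).
have := @eventually_gt0 _ (fun t => (a + 1) * t - z t)
   (fun t => (a + 1) - (a - b * r t)) T 1 ltac:(lra).
move=> /(_ (fun t Tt => is_derive_lsub _ (proj1 (H t Tt)))) up.
apply: filterS (up _) => [t|t Tt zt]; first by rewrite subr_gt0 => /ltW.
have [_ rt] := H t Tt; nra.
Qed.

Lemma linear_growth : z t / t @[t --> +oo] --> c.
Proof.
have [k [k0 zk]] := linear_lower_bound.
have t_gt0 := nbhs_pinfty_gt (num_real (0 : R)).
apply: cvgr_between => l lc.
  have H : \forall t \near +oo, l * t <= z t.
    apply: (ratchet (P := fun l => \forall t \near +oo, l * t <= z t)
      (k0 := k) _ zk _ lc) => [k1 l1 kl|k1 kk1 k1c].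
      by apply: filterS2 t_gt0 => t t0; apply: le_trans; rewrite ler_pM2r.
    by apply: lower_step => //; lra.
  by apply: filterS2 t_gt0 H => t t0; rewrite ler_pdivlMr.
have H : \forall t \near +oo, z t <= - - l * t.
  apply: (ratchet (P := fun l => \forall t \near +oo, z t <= - l * t)
      (k0 := - (a + 1)) (c := - c)) => [k1 l1 kl||k1 kk1 k1c|].
  - by apply: filterS2 t_gt0 => t t0 /le_trans; apply; rewrite ler_pM2r//; lra.
  - by rewrite opprK; exact: linear_upper_bound.
  - have [e [e0 up]] := @upper_step (- k1) ltac:(lra).
    by exists e; rewrite opprB opprD addrC.
  - by rewrite ltrN2.
by apply: filterS2 t_gt0 H => t t0; rewrite opprK ler_pdivrMr.
Qed.
End linear_growth.

(** * Exponential decay in the clock S *)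

Section exponential_decay.
Context {R : realType}.
Variables (x d S sigma g : R -> R) (a b beta : R).
Hypotheses (b_gt0 : 0 < b) (ab : b < a) (beta_gt1 : 1 < beta).
Hypotheses (gRV : RV0 g beta) (g_incr : ndecr_right0 g).
Hypothesis xE : \forall t \near +oo,
  is_derive t (1 : R) x (- a * g (x t) + b * g (x (d t))).
Hypothesis x_gt0 : \forall t \near +oo, 0 < x t.
Hypothesis x0 : x t @[t --> +oo] --> (0 : R).
Hypothesis d_le : \forall t \near +oo, d t <= t.
Hypothesis dy : d t @[t --> +oo] --> +oo.
Hypothesis SE : \forall t \near +oo, is_derive t (1 : R) S (sigma t)^-1.
Hypothesis sigma_gt0 : \forall t \near +oo, 0 < sigma t.
Hypothesis Sy : S t @[t --> +oo] --> +oo.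
Hypothesis Sd : S t - S (d t) @[t --> +oo] --> (1 : R).

Let mu := beta^-1 * ln (a / b).

Lemma is_derive_expS (C m t : R) : is_derive t 1 S (sigma t)^-1 ->
  is_derive t 1 (fun s => C * expR (- m * S s))
    (- m * (sigma t)^-1 * (C * expR (- m * S t))).
Proof.
move=> SEt.
have ? : is_derive t 1 (fun s => - m * S s) (- m * (sigma t)^-1).
  by apply: is_derive_eq.
have ? : is_derive t 1 (fun s => expR (- m * S s))
    (expR (- m * S t) * (- m * (sigma t)^-1)).
  exact: (@is_derive1_comp R expR (fun s => - m * S s)).
by apply: is_derive_eq; rewrite /GRing.scale/=; ring.
Qed.

(** Over one delay the clock S advances by about 1, so the barrier
C exp (- m S) loses a factor close to exp m. *)
Lemma expS_delay_ge (m rho : R) : 0 < rho ->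
  ln rho < m -> \forall t \near +oo,
    forall C, 0 <= C -> rho * (C * expR (- m * S t)) <= C * expR (- m * S (d t)).
Proof.
move=> rho0 rm; have m1 : m * (S t - S (d t)) @[t --> +oo] --> m.
  by rewrite -[X in _ --> X]mulr1; apply: cvgM; [exact: cvg_cst|exact: Sd].
apply: filterS (cvgr_gt _ m1 _ rm) => t rt C C0.
have -> : - m * S (d t) = m * (S t - S (d t)) + - m * S t by ring.
rewrite expRD mulrCA ler_wpM2l// ler_pM2r ?expR_gt0//.
by rewrite -[leLHS]lnK ?posrE// ler_expR ltW.
Qed.

Lemma expS_delay_le (m rho : R) : 0 < rho ->
  m < ln rho -> \forall t \near +oo,
    forall C, 0 <= C -> C * expR (- m * S (d t)) <= rho * (C * expR (- m * S t)).
Proof.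
move=> rho0 rm; have m1 : m * (S t - S (d t)) @[t --> +oo] --> m.
  by rewrite -[X in _ --> X]mulr1; apply: cvgM; [exact: cvg_cst|exact: Sd].
apply: filterS (cvgr_lt _ m1 _ rm) => t rt C C0.
have -> : - m * S (d t) = m * (S t - S (d t)) + - m * S t by ring.
rewrite expRD [leRHS]mulrCA ler_wpM2l// ler_pM2r ?expR_gt0//.
by rewrite -[leRHS]lnK ?posrE// ler_expR ltW.
Qed.

(** For m > mu the curve C exp (- m S) is a lower barrier: over one delay it
decreases by a factor rho with rho ^ beta > a / b, so where x touches it the
delayed gain b g (x (d t)) exceeds the loss a g (x t), and x increases. *)
Lemma exp_lower_bound (m : R) : mu < m ->
  exists C, 0 < C /\ \forall t \near +oo, C * expR (- m * S t) <= x t.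
Proof.
move=> mum.
have b0 := b_gt0; have ab' := ab; have b1 := beta_gt1.
have ab0 : 0 < a / b by rewrite divr_gt0//; lra.
have mu0 : 0 < mu.
  rewrite mulr_gt0 ?invr_gt0//; first lra.
  by rewrite ln_gt0// ltr_pdivlMr// mul1r.
pose rho := expR ((mu + m) / 2).
have rho0 : 0 < rho by exact: expR_gt0.
have rm : ln rho < m by rewrite /rho expRK; lra.
have rhoK : a / b < rho `^ beta.
  rewrite -ltr_ln_pos ?powR_gt0// ln_powR /rho expRK.
  have : ln (a / b) = beta * mu by rewrite /mu; field; rewrite gt_eqF//; lra.
  move=> ->; rewrite ltr_pM2l; lra.
pose K := (a / b + rho `^ beta) / 2.
have [e' [e'0 H0']] := RV0_ge_scale gRV g_incr rho0
  (ltac:(rewrite /K; lra) : K < rho `^ beta).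
have [g_gt0 _] := gRV; have [e2 [e20 g_gt0']] := (near_at_right0P _).1 g_gt0.
pose e3 := Num.min e' e2.
have e30 : 0 < e3 by rewrite lt_min e'0.
have [T1 [T10 H1]] := near_pinftyW (filterI (filterI xE x_gt0)
   (filterI (cvgr_lt _ x0 _ e30) (filterI (cvgry_gt Sy 0) (filterI SE sigma_gt0)))).
have [T [T0 H]] := near_pinftyW (filterI (filterI d_le (cvgry_gt dy T1))
   (filterI (expS_delay_ge rho0 rm) (nbhs_pinfty_gt (num_real T1)))).
have TT1 : T1 < T by have [_ [_]] := H T (lexx _).
have [t0 t0T x_min] := EVT_min (ltW TT1)
  (is_derive_segment_continuous
    (fun r rr => proj1 (proj1 (H1 r (proj1 (andP rr)))))).
move: t0T; rewrite in_itv/= => t0T.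
have xt0 : 0 < x t0 by have [[_]] := H1 t0 ltac:(lra).
(* Since S >= 0 after T1, this C puts the barrier below x on [T1, T]. *)
pose C := x t0 / 2.
have C0 : 0 < C by rewrite /C; lra.
exists C; split=> //.
apply: near_pinfty_from; exists T1 => t T1t.
rewrite -subr_ge0; apply/ltW; move: t T1t.
apply: (first_crossing (T := T)
  (du := fun t => - a * g (x t) + b * g (x (d t)) -
     - m * (sigma t)^-1 * (C * expR (- m * S t)))).
- move=> t tT; rewrite subr_gt0.
  have [_ [_ [St _]]] := H1 t ltac:(lra).
  apply: (@lt_le_trans _ _ (x t0)); last by apply: x_min; rewrite in_itv.
  have : expR (- m * S t) <= 1 by rewrite expR_le1 mulNr oppr_le0 mulr_ge0//; lra.
  have := xt0; rewrite /C; nra.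
- exact: ltW.
- move=> t Tt; have [[? _] [_ [_ [? _]]]] := H1 t ltac:(lra).
  have ? := @is_derive_expS C m t _.
  exact: is_deriveB.
- move=> t Tt yt hist.
  have [[dt T1d] [Sgap _]] := H t Tt.
  have xd := hist (d t) ltac:(lra).
  have [[_ xt] [xe [_ [_ st]]]] := H1 t ltac:(lra).
  have [_ [xde _]] := H1 (d t) (ltW T1d).
  have gap := Sgap C (ltW C0).
  have xE' : C * expR (- m * S t) = x t by lra.
  rewrite xE' in gap.
  move: xe xde; rewrite !lt_min => /andP[xe' xe2] /andP[xde' _].
  have gx := g_gt0' (x t) ltac:(by rewrite xt).
  have := H0' (x t) (x (d t)) ltac:(by rewrite xt) ltac:(rewrite xde' andbT; lra).
  have aK : a < b * K.
    have : a / b < K by rewrite /K; lra.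
    by rewrite ltr_pdivrMr// mulrC.
  move=> gK.
  have h1 : b * (K * g (x t)) <= b * g (x (d t)) by rewrite ler_pM2l.
  have h2 : a * g (x t) < b * K * g (x t) by rewrite ltr_pM2r.
  have h3 : 0 < m * (sigma t)^-1 * (C * expR (- m * S t)).
    by rewrite !mulr_gt0 ?invr_gt0 ?expR_gt0//; lra.
  lra.
Qed.

Variable lam : R.
Hypothesis lam_mu : mu * (beta - 1) < lam.
Hypothesis sigma_ge : \forall t \near +oo, lam * t <= sigma t.

(** Comparing derivatives, lam S <= ln t + const, hence sigma t >= lam t grows at
least like exp (lam S), which beats exp (m S). *)
Lemma sigma_exp_pinfty (m : R) : 0 <= m -> m < lam ->
  sigma t * expR (- m * S t) @[t --> +oo] --> +oo.
Proof.
move=> m0 mlam.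
have [T [T0 H]] := near_pinftyW (filterI (filterI SE sigma_gt0)
  (filterI sigma_ge (cvgry_gt Sy 0))).
have lam0 : 0 < lam by lra.
pose k0 := ln T - lam * S T.
have lnS t : T <= t -> lam * S t + k0 <= ln t.
  move=> Tt.
  have dS r : T <= r <= t -> is_derive r 1 (fun s => lam * S s) (lam * (sigma r)^-1).
    by move=> rr; have [[? _] _] := H r ltac:(lra); apply: is_derive_eq.
  have dln r : T <= r <= t -> is_derive r 1 (@ln R) r^-1.
    by move=> rr; apply: is_derive1_ln; lra.
  have := ler_increment Tt dS dln _; rewrite /k0 => inc.
  suff : lam * S t - lam * S T <= ln t - ln T by lra.
  apply: inc => r rr; have [[_ sr] [lr _]] := H r ltac:(lra).
  have r0 : 0 < r by lra.
  by rewrite ler_pdivrMr// ler_pdivlMl// mulrC.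
have Sc : lam * expR k0 * ((lam - m) * S t) @[t --> +oo] --> +oo.
  apply: gt0_cvgMry; first by rewrite mulr_gt0// expR_gt0.
  apply: gt0_cvgMry => //; lra.
apply: ger_cvgy Sc.
apply: near_pinfty_from; exists T => t Tt.
have [_ [lt _]] := H t Tt.
have t0 : 0 < t by lra.
apply: (@le_trans _ _ (lam * t * expR (- m * S t))); last first.
  by rewrite ler_pM2r// expR_gt0.
rewrite -!mulrA ler_pM2l//.
apply: (@le_trans _ _ (expR (lam * S t + k0) * expR (- m * S t))); last first.
  by rewrite ler_pM2r ?expR_gt0// -[leRHS]lnK ?posrE// ler_expR lnS.
rewrite -expRD.
have -> : lam * S t + k0 + - m * S t = k0 + (lam - m) * S t by ring.
rewrite expRD ler_pM2l ?expR_gt0//.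
have := expR_ge1Dx ((lam - m) * S t); lra.
Qed.

(** For m < mu the curve C exp (- m S) is an upper barrier: the factor lost over
one delay satisfies rho ^ beta < a / b, so where x touches the curve it
decreases at a rate of at least eta g (x t), that is of order x ^ p for any p
above beta. This exceeds the slope m x / sigma of the curve since sigma is
large compared with x ^ (1 - p). *)
Lemma exp_upper_bound (m : R) : 0 < m -> m < mu ->
  exists C, 0 < C /\ \forall t \near +oo, x t <= C * expR (- m * S t).
Proof.
move=> m0 mum.
have b0 := b_gt0; have ab' := ab; have b1 := beta_gt1; have lm := lam_mu.
have ab0 : 0 < a / b by rewrite divr_gt0//; lra.
pose rho := expR ((mu + m) / 2).
have rho0 : 0 < rho by exact: expR_gt0.
have rm : m < ln rho by rewrite /rho expRK; lra.
have rhoK : rho `^ beta < a / b.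
  rewrite -ltr_ln_pos ?powR_gt0// ln_powR /rho expRK.
  have : ln (a / b) = beta * mu by rewrite /mu; field; rewrite gt_eqF//; lra.
  move=> ->; rewrite ltr_pM2l; lra.
pose K := (a / b + rho `^ beta) / 2.
have [e [e0 H0]] := RV0_le_scale gRV g_incr rho0
  (ltac:(rewrite /K; lra) : rho `^ beta < K).
have bK : b * K < a.
  have : K < a / b by rewrite /K; lra.
  by rewrite ltr_pdivlMr// mulrC.
pose eta := a - b * K.
have eta0 : 0 < eta by rewrite /eta; lra.
have mlam : m * (beta - 1) < lam by nra.
(* An exponent p > beta so close to beta that still m (p - 1) < lam. *)
pose p := ((m * (beta - 1) + lam) / 2) / m + 1.
have pE : m * (p - 1) = (m * (beta - 1) + lam) / 2.
  by rewrite /p; field; rewrite gt_eqF.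
have bp : beta < p by nra.
have [c [c0 H2]] := RV0_ge_powR gRV g_incr (ltac:(lra) : 0 <= p) bp.
have [e2 [e20 H2']] := (near_at_right0P _).1 H2.
have sy := @sigma_exp_pinfty (m * (p - 1)) ltac:(nra) ltac:(lra).
pose e3 := Num.min 1 (Num.min e e2).
have e30 : 0 < e3 by rewrite !lt_min ltr01 e0.
have [T1 [T10 H1]] := near_pinftyW (filterI (filterI xE x_gt0)
   (filterI (cvgr_lt _ x0 _ e30) (filterI (cvgry_gt Sy 0) (filterI SE sigma_gt0)))).
have [T [T0 H]] := near_pinftyW (filterI (filterI d_le (cvgry_gt dy T1))
   (filterI (expS_delay_le rho0 rm) (filterI (nbhs_pinfty_gt (num_real T1))
     (cvgry_gt sy (m / (eta * c)))))).
have TT1 : T1 < T by have [_ [_ []]] := H T (lexx _).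
have S_incr r s : T1 <= r <= s -> S r <= S s.
  move=> /andP[T1r rs]; rewrite -subr_ge0.
  have := ler_increment (f := cst 0) (df := cst 0) (k := S)
    (dk := fun t => (sigma t)^-1) rs (fun q _ => is_derive_cst 0 q 1).
  rewrite subrr; apply.
    by move=> q rq; have [_ [_ [_ []]]] := H1 q ltac:(lra).
  by move=> q rq; have [_ [_ [_ [_ sq]]]] := H1 q ltac:(lra); rewrite invr_ge0 ltW.
have ST : 0 < S T by have [_ [_ []]] := H1 T (ltW TT1).
(* This C makes the barrier at least 1 on [T1, T], where x < 1. *)
pose C := expR (m * S T).
have C1 : 1 < C by rewrite expR_gt1 mulr_gt0.
have C0 : 0 < C by lra.
exists C; split=> //.
apply: near_pinfty_from; exists T1 => t T1t.
rewrite -subr_ge0; apply/ltW; move: t T1t.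
apply: (first_crossing (T := T)
  (du := fun t => - m * (sigma t)^-1 * (C * expR (- m * S t)) -
     (- a * g (x t) + b * g (x (d t))))).
- move=> t tT; rewrite subr_gt0.
  have [_ [xe _]] := H1 t ltac:(lra).
  move: xe; rewrite lt_min => /andP[xe _].
  apply: (lt_le_trans xe).
  rewrite -expRD -[leLHS]expR0 ler_expR.
  have : S t <= S T by apply: S_incr; lra.
  nra.
- exact: ltW.
- move=> t Tt; have [[? _] [_ [_ [? _]]]] := H1 t ltac:(lra).
  have ? := @is_derive_expS C m t _.
  exact: is_deriveB.
- move=> t Tt yt hist.
  have [[dt T1d] [Sgap [_ sbig]]] := H t Tt.
  have xd := hist (d t) ltac:(lra).
  have [[_ xt] [xe [_ [_ st]]]] := H1 t ltac:(lra).
  have [[_ xdt] _] := H1 (d t) (ltW T1d).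
  have gap := Sgap C (ltW C0).
  have xE' : C * expR (- m * S t) = x t by lra.
  rewrite xE' in gap.
  move: xe; rewrite !lt_min => /and3P[_ xe' xe2].
  have gx := H2' (x t) ltac:(by rewrite xt).
  have := H0 (x t) (x (d t)) ltac:(by rewrite xt) ltac:(rewrite xdt/=; lra).
  move=> gK.
  have h1 : b * g (x (d t)) <= b * (K * g (x t)) by rewrite ler_pM2l.
  rewrite xE'.
  have xp : x t * expR (- (m * (p - 1)) * S t) <= x t `^ p.
    have -> : p = 1 + (p - 1) by ring.
    rewrite powRD; last by rewrite (gt_eqF xt) implybT.
    rewrite powRr1 ?(ltW xt)// ler_pM2l//.
    have -> : - (m * (1 + (p - 1) - 1)) * S t = (- m * S t) * (p - 1) by ring.
    rewrite expRM ge0_ler_powR ?nnegrE ?expR_ge0 ?(ltW xt)//; first lra.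
    by rewrite -xE' ler_peMl ?expR_ge0// ltW.
  (* The slope of the barrier is dominated by the instantaneous dissipation. *)
  have h2 : m * (sigma t)^-1 * x t < eta * (c * (x t * expR (- (m * (p - 1)) * S t))).
    have -> : m * (sigma t)^-1 * x t =
        m / (eta * c) * (eta * c * x t * (sigma t)^-1).
      by field; rewrite !gt_eqF.
    have -> : eta * (c * (x t * expR (- (m * (p - 1)) * S t))) =
        sigma t * expR (- (m * (p - 1)) * S t) * (eta * c * x t * (sigma t)^-1).
      by field; rewrite !gt_eqF.
    by rewrite ltr_pM2r// !mulr_gt0// invr_gt0.
  have h3 : eta * (c * (x t * expR (- (m * (p - 1)) * S t))) <= eta * g (x t).
    rewrite ler_pM2l//; apply: le_trans gx; by rewrite ler_pM2l.
  rewrite /eta in h2 h3; lra.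
Qed.

Lemma exponential_decay : ln (x t) / S t @[t --> +oo] --> - mu.
Proof.
have b0 := b_gt0; have ab' := ab; have b1 := beta_gt1.
have mu0 : 0 < mu.
  rewrite mulr_gt0 ?invr_gt0//; first lra.
  by rewrite ln_gt0// ltr_pdivlMr// mul1r.
apply: cvgr_between => c cmu.
  pose m := (mu - c) / 2.
  have [C [C0 H]] := @exp_lower_bound m ltac:(rewrite /m; lra).
  near=> t.
  have St : 0 < S t by near: t; exact: cvgry_gt.
  have Ct : C * expR (- m * S t) <= x t by near: t.
  have xt : 0 < x t by near: t.
  have big : - ln C / (- m - c) < S t by near: t; exact: cvgry_gt.
  rewrite ler_pdivlMr//.
  move: Ct; rewrite -ler_ln ?posrE ?mulr_gt0 ?expR_gt0//.
  rewrite lnM ?posrE ?expR_gt0// expRK.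
  by move: big; rewrite ltr_pdivrMr; rewrite /m; lra.
have [cge|clt] := leP 0 c.
  near=> t.
  have St : 0 < S t by near: t; exact: cvgry_gt.
  have xt : x t < 1 by near: t; apply: (cvgr_lt _ x0); exact: ltr01.
  rewrite ler_pdivrMr//; apply: (@le_trans _ _ 0); first by rewrite ln_le0// ltW.
  by rewrite mulr_ge0// ltW.
pose m := (mu - c) / 2.
have [C [C0 H]] := @exp_upper_bound m ltac:(rewrite /m; lra) ltac:(rewrite /m; lra).
near=> t.
have St : 0 < S t by near: t; exact: cvgry_gt.
have Ct : x t <= C * expR (- m * S t) by near: t.
have xt : 0 < x t by near: t.
have big : ln C / (m + c) < S t by near: t; exact: cvgry_gt.
rewrite ler_pdivrMr//.
move: Ct; rewrite -ler_ln ?posrE ?mulr_gt0 ?expR_gt0//.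
rewrite lnM ?posrE ?expR_gt0// expRK.
by move: big; rewrite ltr_pdivrMr; rewrite /m; lra.
Unshelve. all: by end_near. Qed.
End exponential_decay.

(** * Integrals of reciprocals *)

Section recip_int.
Context {R : realType}.
Implicit Types (f : R -> R).
Local Notation mu := (@lebesgue_measure R).

Lemma recip_EFin f s : 0 < f s -> recip f s = ((f s)^-1)%:E.
Proof. by move=> fs; rewrite /recip inver gt_eqF. Qed.

Lemma recip_intD f (c s t : R) : c <= s -> s <= t ->
  mu.-integrable `[c, t] (recip f) ->
  recip_int f c t = recip_int f c s + recip_int f s t.
Proof.
move=> cs st If.
have sub (i : interval R) : [set` i] `<=` `[c, t] ->
    mu.-integrable [set` i] (recip f).
  by move=> ict; exact: integrableS If.
have I1 : mu.-integrable `[c, s] (recip f).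
  by apply: sub; apply: subset_itvl; rewrite bnd_simp.
have I2 : mu.-integrable `[s, t] (recip f).
  by apply: sub; apply: subset_itvr; rewrite bnd_simp.
have I3 : mu.-integrable `]s, t] (recip f).
  by apply: sub; apply: subset_itvr; rewrite bnd_simp.
have E : `[c, t]%classic = `[c, s]%classic `|` `]s, t]%classic.
  by rewrite -itv_bndbnd_setU// bnd_simp.
rewrite /recip_int E integral_setU//=.
- rewrite integral_itv_obnd_cbnd; last exact: measurable_int I3.
  by rewrite fineD//; exact: integrable_fin_num.
- by rewrite -E; exact: measurable_int If.
- apply/disj_setPS => r /= []; rewrite !in_itv/= => /andP[_ rs] /andP[sr _].
  by move: rs; rewrite leNgt sr.
Qed.

Lemma recip_int_ge0 f (c d : R) : (forall s, c <= s <= d -> 0 < f s) ->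
  0 <= recip_int f c d.
Proof.
move=> f0; apply: fine_ge0; apply: integral_ge0 => s /=; rewrite in_itv/= => csd.
by rewrite recip_EFin ?f0// lee_fin invr_ge0 ltW// f0.
Qed.

Lemma integrable_recip f (c d : R) :
  (forall s, c <= s <= d -> 0 < f s) ->
  {within `[c, d], continuous f} ->
  mu.-integrable `[c, d] (recip f).
Proof.
move=> f0 fc.
apply: (@eq_integrable _ _ _ mu _ _ (EFin \o (fun s => (f s)^-1))).
- exact: measurable_itv.
- by move=> s; rewrite inE/= in_itv/= => csd; rewrite recip_EFin ?f0.
apply: continuous_compact_integrable; first exact: segment_compact.
rewrite continuous_subspace_in => s; rewrite inE/= in_itv/= => csd.
by apply: continuousV; [rewrite gt_eqF// f0|exact: fc].
Qed.

(** Integrals are taken of the extended reciprocal, whose value at a zero is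
infinite. Past s0, where f is positive, this is the real reciprocal and the
fundamental theorem of calculus applies; the part before s0 is a constant. *)
Lemma is_derive_recip_int f (c s0 t u : R) : c <= s0 -> s0 < t -> t < u ->
  (forall s, s0 <= s <= u -> 0 < f s) ->
  mu.-integrable `[c, u] (recip f) ->
  {for t, continuous f} ->
  is_derive t 1 (recip_int f c) (f t)^-1.
Proof.
move=> cs0 s0t tu f0 If fc.
have sub (i : interval R) : [set` i] `<=` `[c, u] ->
    mu.-integrable [set` i] (recip f).
  by move=> icu; exact: integrableS If.
have I1 : mu.-integrable `[s0, u] (EFin \o (fun s => (f s)^-1)).
  apply: (@eq_integrable _ _ _ mu _ _ (recip f)).
  - exact: measurable_itv.
  - by move=> s; rewrite inE/= in_itv/= => su; rewrite recip_EFin ?f0.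
  - by apply: sub; apply: subset_itvr; rewrite bnd_simp.
have fcV : {for t, continuous (fun s => (f s)^-1)}.
  by apply: continuousV => //; rewrite gt_eqF// f0//; lra.
have [dF FE] := continuous_FTC1_closed tu I1 s0t fcV.
pose F s := recip_int f c s0 + \int[mu]_(r in `[s0, s]) (f r)^-1.
have FD : is_derive t 1 F (f t)^-1.
  rewrite -[X in is_derive _ _ _ X]add0r -FE derive1E.
  apply: is_deriveD; exact/derivableP.
apply: (near_eq_is_derive _ FD).
near=> s.
have s0s : s0 < s by near: s; exact: lt_nbhsr.
have su : s < u by near: s; exact: lt_nbhsl.
rewrite (@recip_intD _ c s0 s)//; last 2 first.
- exact: ltW.
- by apply: sub; apply: subset_itvl; rewrite bnd_simp ltW.
congr (_ + _); rewrite /recip_int /Rintegral; congr fine.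
apply: eq_integral => r; rewrite inE/= in_itv/= => rs.
by rewrite recip_EFin// f0//; lra.
Unshelve. all: by end_near. Qed.

Lemma within_cy_continuous f (c t : R) : {within `[c, +oo[, continuous f} ->
  c < t -> {for t, continuous f}.
Proof.
by move=> /continuous_within_itvcyP[fc _] ct; apply: fc; rewrite in_itv/= ct.
Qed.
End recip_int.

(** * The function G and its inverse *)

Section bigG.
Context {R : realType}.
Variable g : R -> R.
Hypothesis g_gt0 : forall y, 0 < y -> 0 < g y.
Hypothesis g_cont : forall y, 0 < y -> {for y, continuous g}.

Lemma integrable_recip_pos (c d : R) : 0 < c ->
  (@lebesgue_measure R).-integrable `[c, d] (recip g).
Proof.
move=> c0; apply: integrable_recip => [s cs|]; first by apply: g_gt0; lra.
apply: continuous_in_subspaceT => s; rewrite inE/= in_itv/= => cs.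
by apply: g_cont; lra.
Qed.

Lemma is_derive_bigG (y : R) : 0 < y < 1 -> is_derive y 1 (bigG g) (- (g y)^-1).
Proof.
move=> y01.
(* A base point h in (0, y) turns the lower limit of integration into an upper
   one. *)
pose h := y / 2.
have dh : is_derive y 1 (recip_int g h) (g y)^-1.
  apply: (@is_derive_recip_int R g h h y 1); rewrite /h; try lra.
  - by move=> s hs; apply: g_gt0; lra.
  - by apply: integrable_recip_pos; lra.
  - by apply: g_cont; lra.
pose F s := recip_int g h 1 - recip_int g h s.
have FD : is_derive y 1 F (- (g y)^-1).
  by rewrite -[X in is_derive _ _ _ X]add0r; exact: is_deriveB.
apply: (near_eq_is_derive _ FD).
near=> s.
have hs : h < s by near: s; apply: lt_nbhsr; rewrite /h; lra.
have s1 : s < 1 by near: s; apply: lt_nbhsl; lra.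
rewrite /F /bigG ltW// (@recip_intD R g h s 1) ?ltW//; first by rewrite addrC addKr.
by apply: integrable_recip_pos; rewrite /h; lra.
Unshelve. all: by end_near. Qed.

Lemma bigG_le (y w : R) : 0 < y -> y <= w -> y <= 1 -> bigG g w <= bigG g y.
Proof.
move=> y0 yw y1; rewrite /bigG y1.
case: ifPn => [w1|]; last first.
  rewrite -ltNge => w1; apply: (@le_trans _ _ 0).
    by rewrite oppr_le0; apply: recip_int_ge0 => s ?; apply: g_gt0; lra.
  by apply: recip_int_ge0 => s ?; apply: g_gt0; lra.
rewrite (@recip_intD R g y w 1)//; last exact: integrable_recip_pos.
by rewrite lerDr; apply: recip_int_ge0 => s ?; apply: g_gt0; lra.
Qed.

Hypothesis Gy : bigG g y @[y --> 0^'+] --> +oo.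

(** The intermediate value theorem puts every large t in the range of G. *)
Lemma bigG_invP : \forall t \near +oo, 0 < bigG_inv g t /\ bigG g (bigG_inv g t) = t.
Proof.
near=> t.
have [e [e0 eP]] := (near_at_right0P _).1 (cvgry_gt Gy t).
pose y1 := Num.min e 1 / 2.
have y1P : [/\ 0 < y1, y1 < e & y1 <= 2^-1].
  by rewrite /y1; case: (leP e 1) => ?; split; lra.
have [y10 y1e y12] := y1P.
have Gy1 : t < bigG g y1 by apply: eP; rewrite y10.
have tG : bigG g 2^-1 < t by near: t; exact: nbhs_pinfty_gt (num_real _).
have Gc : {within `[y1, 2^-1], continuous (bigG g)}.
  apply: (is_derive_segment_continuous (df := fun y => - (g y)^-1)) => r rr.
  by apply: is_derive_bigG; lra.
have [|y yy Gyt] := @IVT _ (bigG g) y1 2^-1 t y12 Gc.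
  by rewrite ge_min le_max (ltW tG) (ltW Gy1)/= orbT.
have tim : (bigG g @` `]0, +oo[) t.
  by exists y => //=; move: yy; rewrite !in_itv/=; lra.
split; last by apply: pinvK; rewrite inE.
have surj : set_surj `]0, +oo[ (bigG g @` `]0, +oo[) (bigG g) by [].
have := @surjpinv_image_sub _ _ (fun=> 1) _ _ _ surj (bigG_inv g t).
by rewrite /= in_itv/= andbT; apply; exists t.
Unshelve. all: by end_near. Qed.

Lemma bigG_inv_cvg0 : bigG_inv g t @[t --> +oo] --> (0 : R).
Proof.
apply: cvgr_between => c c0.
  by apply: filterS bigG_invP => t [+ _]; lra.
pose e := Num.min c 1.
have e0 : 0 < e by rewrite lt_min c0 ltr01.
apply: filterS2 bigG_invP (nbhs_pinfty_gt (num_real (bigG g e))) => t [y0 yt] Ge.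
rewrite leNgt; apply/negP => cy.
have := @bigG_le e (bigG_inv g t) e0 _ _; rewrite yt.
rewrite /e !ge_min (ltW cy) lexx orbT/= => /(_ isT isT); rewrite -/e; lra.
Qed.
End bigG.

(** * The delay measured in logarithmic time *)

Section clock.
Context {R : realType}.
Variables (d S sigma : R -> R) (l : R).
Hypothesis d_le : \forall t \near +oo, d t <= t.
Hypothesis dy : d t @[t --> +oo] --> +oo.
Hypothesis SE : \forall t \near +oo, is_derive t (1 : R) S (sigma t)^-1.
Hypothesis sigma_gt0 : \forall t \near +oo, 0 < sigma t.
Hypothesis Sy : S t @[t --> +oo] --> +oo.
Hypothesis Sd : S t - S (d t) @[t --> +oo] --> (1 : R).
Hypothesis sigma_l : sigma t / t @[t --> +oo] --> l.

(** Both ln and S are primitives, of 1 / t and 1 / sigma, and the quotient of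
these derivatives tends to l. The length of the delay and the growth of S are
both read off from this comparison. *)
Lemma ln_increment (e : R) : 0 < e -> exists T, 0 < T /\
  forall s t, T <= s <= t ->
    (l - e) * (S t - S s) <= ln t - ln s <= (l + e) * (S t - S s).
Proof.
move=> e0.
have le1 : l - e < l by lra.
have le2 : l < l + e by lra.
have [T [T0 H]] := near_pinftyW (filterI (filterI SE sigma_gt0)
  (filterI (cvgr_ge _ sigma_l _ le1) (cvgr_le _ sigma_l _ le2))).
exists T; split=> // s t /andP[Ts st].
have dS (c r : R) : s <= r <= t -> is_derive r 1 (fun q => c * S q) (c * (sigma r)^-1).
  by move=> rr; have [[? _] _] := H r ltac:(lra); apply: is_derive_eq.
have dln r : s <= r <= t -> is_derive r 1 (@ln R) r^-1.
  by move=> rr; apply: is_derive1_ln; lra.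
have lo := ler_increment st (dS (l - e)) dln.
have up := ler_increment st dln (dS (l + e)).
rewrite !mulrBr; apply/andP; split.
  apply: lo => r rr; have [[_ sr] [+ _]] := H r ltac:(lra).
  have r0 : 0 < r by lra.
  by rewrite ler_pdivlMr// ler_pdivrMr// ler_pdivlMl// mulrC.
apply: up => r rr; have [[_ sr] [_ +]] := H r ltac:(lra).
have r0 : 0 < r by lra.
by rewrite ler_pdivrMr// ler_pdivlMr// ler_pdivrMl// mulrC.
Qed.

Lemma cvg_ln_delay : ln t - ln (d t) @[t --> +oo] --> l.
Proof.
apply: cvgr_between => c.
  move=> cl; pose e := (l - c) / 2.
  have [T [T0 H]] := ln_increment (ltac:(rewrite /e; lra) : 0 < e).
  have lim : (l - e) * (S t - S (d t)) @[t --> +oo] --> l - e.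
    by rewrite -[X in _ --> X]mulr1; apply: cvgM; [exact: cvg_cst|exact: Sd].
  apply: filterS3 d_le (cvgry_ge dy T)
    (cvgr_ge _ lim _ (ltac:(rewrite /e; lra) : c < l - e)) => t dt Td ct.
  by have := H (d t) t; rewrite Td dt => /(_ isT); lra.
move=> cl; pose e := (c - l) / 2.
have [T [T0 H]] := ln_increment (ltac:(rewrite /e; lra) : 0 < e).
have lim : (l + e) * (S t - S (d t)) @[t --> +oo] --> l + e.
  by rewrite -[X in _ --> X]mulr1; apply: cvgM; [exact: cvg_cst|exact: Sd].
apply: filterS3 d_le (cvgry_ge dy T)
  (cvgr_le _ lim _ (ltac:(rewrite /e; lra) : l + e < c)) => t dt Td ct.
by have := H (d t) t; rewrite Td dt => /(_ isT); lra.
Qed.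

Lemma cvg_delay_ratio : d t / t @[t --> +oo] --> expR (- l).
Proof.
have H : expR (- (ln t - ln (d t))) @[t --> +oo] --> expR (- l).
  apply: (cvg_comp _ _ (cvgN cvg_ln_delay)); exact: continuous_expR.
apply: cvg_trans H; apply: near_eq_cvg.
apply: filterS2 (cvgry_gt dy 0) (nbhs_pinfty_gt (num_real 0)) => t dt t0.
by rewrite opprB expRB !lnK ?posrE.
Qed.

Lemma cvg_ln_clock : ln t / S t @[t --> +oo] --> l.
Proof.
apply: cvgr_between => c.
  move=> cl; pose e := (l - c) / 2.
  have e0 : 0 < e by rewrite /e; lra.
  have [T [T0 H]] := ln_increment e0.
  apply: filterS3 (cvgry_gt Sy 0) (nbhs_pinfty_ge (num_real T))
    (cvgry_gt Sy (((l - e) * S T - ln T) / e)) => t St Tt.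
  rewrite ltr_pdivrMr// ler_pdivlMr//.
  have := H T t; rewrite lexx Tt => /(_ isT) /andP[+ _].
  have -> : c = l - e - e by rewrite /e; field.
  lra.
move=> cl; pose e := (c - l) / 2.
have e0 : 0 < e by rewrite /e; lra.
have [T [T0 H]] := ln_increment e0.
apply: filterS3 (cvgry_gt Sy 0) (nbhs_pinfty_ge (num_real T))
  (cvgry_gt Sy ((ln T - (l + e) * S T) / e)) => t St Tt.
rewrite ltr_pdivrMr// ler_pdivrMr//.
have := H T t; rewrite lexx Tt => /(_ isT) /andP[_ +].
have -> : c = l + e + e by rewrite /e; field.
lra.
Qed.
End clock.

(** * Lower and upper limits *)

Section limf.
Context {R : realType}.

Lemma limf_einf_le_esup (f : R -> \bar R) :
  (limf_einf f (pinfty_nbhs R) <= limf_esup f (pinfty_nbhs R))%E.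
Proof.
rewrite limf_einfE limf_esupE.
apply: ge_ereal_sup => _ [V FV <-]; apply: le_ereal_inf_tmp => _ [W FW <-].
have [t [Vt Wt]] := filter_ex (filterI FV FW).
apply: (@le_trans _ _ (f t)).
  by apply: ereal_inf_lbound; exists t.
by apply: ereal_sup_ubound; exists t.
Qed.

Lemma cvg_limf (f : R -> R) (L : R) : f t @[t --> +oo] --> L ->
  (L%:E <= limf_einf (fun t => (f t)%:E) (pinfty_nbhs R))%E /\
  (limf_esup (fun t => (f t)%:E) (pinfty_nbhs R) <= L%:E)%E.
Proof.
move=> fL; rewrite limf_einfE limf_esupE; split.
  apply/lee_subgt0Pr => e e0.
  have Le : L - e < L by lra.
  have H := cvgr_ge _ fL _ Le.
  apply: le_trans (ereal_sup_ubound _); last by exists [set t | L - e <= f t]; [exact: H|].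
  by apply: le_ereal_inf_tmp => _ [t + <-] => /= ?; rewrite -EFinB lee_fin.
apply/lee_addgt0Pr => e e0.
have Le : L < L + e by lra.
have H := cvgr_le _ fL _ Le.
apply: le_trans (ereal_inf_lbound _) _; first by exists [set t | f t <= L + e]; [exact: H|].
by apply: ge_ereal_sup => _ [t + <-] => /= ?; rewrite -EFinD lee_fin.
Qed.
End limf.

(** * The delay equation *)

(** The change of variable z t = G (x t) turns the delay equation into
z' = a - b g (x (d t)) / g (x t), to which the linear growth theorem applies;
inverting G gives the asymptotics of x. *)
Lemma cvg_ratio_bigG_inv (R : realType) (x d g : R -> R) (a b p beta : R) :
  0 < b -> 0 < p -> 1 < beta ->
  0 < a - b * p `^ (- (beta / (beta - 1))) ->
  (forall y, 0 < y -> 0 < g y) ->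
  (forall y, 0 < y -> {for y, continuous g}) ->
  RV0 g beta -> ndecr_right0 g ->
  (\forall t \near +oo,
    is_derive t (1 : R) x (- a * g (x t) + b * g (x (d t)))) ->
  (\forall t \near +oo, 0 < x t) -> x t @[t --> +oo] --> (0 : R) ->
  (\forall t \near +oo, d t <= t) -> d t @[t --> +oo] --> +oo ->
  d t / t @[t --> +oo] --> p ->
  x t / bigG_inv g t @[t --> +oo] -->
    (a - b * p `^ (- (beta / (beta - 1)))) `^ (- (beta - 1)^-1).
Proof.
move=> b0 p0 b1 c0 g_gt0 g_cont gRV g_incr xE x_gt0 x0 d_le dy dp.
have GE : \forall y \near 0^'+, is_derive y (1 : R) (bigG g) (- (g y)^-1).
  apply/near_at_right0P; exists 1; split=> // y y01; exact: is_derive_bigG.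
have Gy := primitive_pinfty b1 gRV g_incr GE.
have small P : (\forall y \near 0^'+, P y) ->
    \forall t \near +oo, P (x t) /\ P (x (d t)).
  move=> /near_at_right0P[e [e0 eP]].
  have xP : \forall t \near +oo, P (x t).
    apply: filterS2 x_gt0 (cvgr_lt _ x0 _ e0) => t xt xte.
    by apply: eP; rewrite xt.
  apply: filterS2 xP (near_pinfty_after dy xP) => t Pt Pd.
  by split=> //; exact: Pd.
have smallE e : 0 < e -> \forall t \near +oo, 0 < x t < e /\ 0 < x (d t) < e.
  by move=> e0; apply: (small (fun y => 0 < y < e)); apply/near_at_right0P; exists e.
apply: (primitive_inv_asymp b1 gRV g_incr GE c0 x_gt0 _ x0 (bigG_inv_cvg0 _ _ Gy)) => //.
  by apply: filterS (bigG_invP g_gt0 g_cont Gy) => t [].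
have theta0 : 0 < beta / (beta - 1) by rewrite divr_gt0//; lra.
have lim : bigG g (x t) / t @[t --> +oo] --> a - b * p `^ (- (beta / (beta - 1))).
  apply: (@linear_growth R (fun t => bigG g (x t)) (fun t => g (x (d t)) / g (x t))
    d a b p (beta / (beta - 1))) => //.
  - apply: filterS3 xE (small _ GE) x_gt0 => t xtE [GxE _] xt.
    have := @is_derive1_comp R (bigG g) x t _ _ GxE xtE.
    congr is_derive; field; rewrite gt_eqF//; exact: g_gt0.
  - apply: filterS (small _ gRV.1) => t [gx gxd].
    by rewrite ltW// divr_gt0.
  - by apply: filterS (small _ (cvgry_ge Gy 1)) => t [].
  - move=> rho M rho0 rM.
    have [e [e0 H]] := primitive_compose_le b1 gRV g_incr GE rho0 rM.
    apply: filterS (smallE e e0) => t [xt xdt] Gle.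
    have gx : 0 < g (x t) by apply: g_gt0; lra.
    by rewrite ler_pdivrMr//; exact: H.
  - move=> rho M rho0 M0 rM.
    have [e [e0 H]] := primitive_compose_ge b1 gRV g_incr GE rho0 M0 rM.
    apply: filterS (smallE e e0) => t [xt xdt] Gle.
    have gx : 0 < g (x t) by apply: g_gt0; lra.
    by rewrite ler_pdivlMr//; exact: H.
apply: cvg_trans lim; apply: near_eq_cvg.
by apply: filterS (bigG_invP g_gt0 g_cont Gy) => t [_ ->].
Qed.

Theorem theorem10 (R : realType)
  (tau : R -> R)
  (tau_cont : {within `[0, +oo[, continuous tau})
  (tau_ge0 : forall t : R, 0 <= t -> 0 <= tau t)
  (tau_lim : t - tau t @[t --> +oo] --> +oo)
  (taubar : R)
  (taubarE : - taubar = inf [set t - tau t | t in `[0, +oo[])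
  (sigma : R -> R)
  (sigma_cont : {within `[- taubar, +oo[, continuous sigma})
  (sigma_ge0 : forall t : R, - taubar <= t -> 0 <= sigma t)
  (sigma_int : forall c d : R, - taubar <= c -> c <= d ->
     (@lebesgue_measure R).-integrable `[c, d] (recip sigma))
  (sigma_int_lim : recip_int sigma 0 t @[t --> +oo] --> +oo)
  (sigma_lim : sigma t @[t --> +oo] --> +oo)
  (sigma_tau_lim : recip_int sigma (t - tau t) t @[t --> +oo] --> (1 : R))
  (lambda : \bar R)
  (lambda_ge0 : (0 <= lambda)%E)
  (lambda_lim : (sigma t / t)%:E @[t --> +oo] --> lambda)
  (a b : R)
  (b_gt0 : 0 < b)
  (ab : b < a)
  (g : R -> R)
  (g_cont : {within `[0, +oo[, continuous g})
  (g0 : g 0 = 0)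
  (g_gt0 : forall x : R, 0 < x -> 0 < g x)
  (delta1 : R)
  (delta1_gt0 : 0 < delta1)
  (g_der : forall x : R, 0 < x < delta1 -> derivable g x 1)
  (g'_cont : forall x : R, 0 < x < delta1 -> {for x, continuous (derive1 g)})
  (g'_gt0 : forall x : R, 0 < x < delta1 -> 0 < derive1 g x)
  (beta : R)
  (beta_gt1 : 1 < beta)
  (g'_RV : RV0 (derive1 g) (beta - 1))
  (psi : R -> R)
  (psi_cont : {within `[- taubar, 0], continuous psi})
  (psi_gt0 : forall t : R, - taubar <= t <= 0 -> 0 < psi t)
  (x : R -> R)
  (x_sol : is_solution tau taubar a b g psi x)
  (x_lim : x t @[t --> +oo] --> (0 : R)) :
  [/\ (lambda = 0%E ->
        x t / bigG_inv g t @[t --> +oo] --> (a - b) `^ (- (beta - 1)^-1)),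
      (forall l : R, lambda = l%:E ->
        0 < l < (beta - 1) / beta * ln (a / b) ->
        let q := 1 - expR (- l) in
        let Lambda :=
          (a - b * (1 / (1 - q)) `^ (beta / (beta - 1)))
            `^ (- (beta - 1)^-1) in
        let ratio := fun t => (x t / bigG_inv g t)%:E in
        [/\ (Lambda%:E <= limf_einf ratio (pinfty_nbhs R))%E,
            (limf_einf ratio (pinfty_nbhs R)
              <= limf_esup ratio (pinfty_nbhs R))%E &
            (limf_esup ratio (pinfty_nbhs R) < +oo)%E]),
      (forall l : R, lambda = l%:E ->
        (beta - 1) / beta * ln (a / b) < l ->
        ln (x t) / ln t @[t --> +oo]
          --> - (beta^-1 * l^-1 * ln (a / b))) &
      (lambda = +oo%E ->
        ln (x t) / recip_int sigma 0 t @[t --> +oo]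
          --> - (beta^-1 * ln (a / b)))].
Proof.
have a0 : 0 < a by lra.
pose d t := t - tau t.
have d_le : \forall t \near +oo, d t <= t.
  apply: filterS (nbhs_pinfty_ge (num_real 0)) => t t0.
  by rewrite /d gerBl; exact: tau_ge0.
have taubar_le0 : - taubar <= 0.
  rewrite taubarE; have [hi|/inf_out->//] := pselect (has_inf [set t - tau t | t in `[0, +oo[]).
  apply: (@le_trans _ _ (0 - tau 0)).
    by apply: (ge_inf hi.2); exists 0 => //=; rewrite in_itv/= lexx.
  by rewrite sub0r oppr_le0 tau_ge0.
have [x_cont x_pos _ _ x_der] := x_sol.
have t_gt0 := nbhs_pinfty_gt (num_real (0 : R)).
have x_gt0 : \forall t \near +oo, 0 < x t.
  by apply: filterS t_gt0 => t t0; apply: x_pos; lra.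
have xE : \forall t \near +oo, is_derive t (1 : R) x (- a * g (x t) + b * g (x (d t))).
  by apply: filterS t_gt0 => t t0; exact: x_der.
have g_cont_pos y : 0 < y -> {for y, continuous g}.
  exact: within_cy_continuous g_cont.
have g_at0 : g y @[y --> 0^'+] --> 0.
  by have /continuous_within_itvcyP[_] := g_cont; rewrite g0.
have gRV : RV0 g beta := RV0_of_derive delta1_gt0 g_der g'_gt0 g_gt0 g_at0 g'_RV.
have g_incr : ndecr_right0 g.
  exists delta1; split=> // y w /andP[y0 yw] wd.
  have gE r : y <= r <= w -> is_derive r 1 g (derive1 g r).
    by move=> rr; rewrite derive1E; apply/derivableP/g_der; lra.
  rewrite -subr_ge0.
  have := ler_increment (f := cst 0) (df := cst 0) yw
    (fun r _ => is_derive_cst 0 r 1) gE.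
  by rewrite subrr; apply=> r rr; apply/ltW/g'_gt0; lra.
pose S := recip_int sigma 0.
have sigma_gt0 : \forall t \near +oo, 0 < sigma t by exact: cvgry_gt.
have SE : \forall t \near +oo, is_derive t (1 : R) S (sigma t)^-1.
  have [T [T0 H]] := near_pinftyW sigma_gt0.
  apply: filterS (nbhs_pinfty_gt (num_real T)) => t Tt.
  apply: (@is_derive_recip_int R sigma 0 T t (t + 1)); try lra.
  - by move=> s ?; apply: H; lra.
  - by apply: sigma_int; lra.
  - by apply: within_cy_continuous sigma_cont _; lra.
have Sd : S t - S (d t) @[t --> +oo] --> (1 : R).
  apply: cvg_trans sigma_tau_lim; apply: near_eq_cvg.
  apply: filterS2 d_le (cvgry_ge tau_lim 0) => t dt d0.
  rewrite /S (@recip_intD R sigma 0 (d t) t)//; first by rewrite [RHS]addrC addKr.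
  by apply: sigma_int => //; apply: le_trans dt.
have lnab : 0 < ln (a / b) by rewrite ln_gt0// ltr_pdivlMr// mul1r.
have ratio_cvg (l : R) : lambda = l%:E -> 0 <= l ->
    l < (beta - 1) / beta * ln (a / b) ->
    x t / bigG_inv g t @[t --> +oo] -->
      (a - b * (expR (- l)) `^ (- (beta / (beta - 1)))) `^ (- (beta - 1)^-1).
  move=> lE l0 l_lt.
  have sigma_l : sigma t / t @[t --> +oo] --> l.
    by apply: (@fine_cvg _ _ _ _ (fun t => (sigma t / t)%:E)); rewrite -lE.
  apply: (cvg_ratio_bigG_inv (d := d)) => //.
  - exact: expR_gt0.
  - rewrite subr_gt0 mulrC -ltr_pdivlMr// -ltr_ln_pos ?powR_gt0 ?expR_gt0 ?divr_gt0//.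
    rewrite ln_powR expRK.
    have -> : ln (a / b) = beta / (beta - 1) * ((beta - 1) / beta * ln (a / b)).
      by field; rewrite !gt_eqF//; lra.
    rewrite mulrNN ltr_pM2l// divr_gt0//; lra.
  - exact: (cvg_delay_ratio d_le tau_lim SE sigma_gt0 Sd sigma_l).
have log_cvg (lam : R) : beta^-1 * ln (a / b) * (beta - 1) < lam ->
    (\forall t \near +oo, lam * t <= sigma t) ->
    ln (x t) / S t @[t --> +oo] --> - (beta^-1 * ln (a / b)).
  move=> lam_gt sigma_ge.
  exact: (exponential_decay (d := d) (sigma := sigma) (g := g) b_gt0 ab beta_gt1
    gRV g_incr xE x_gt0 x_lim d_le tau_lim SE sigma_gt0 sigma_int_lim Sd lam_gt
    sigma_ge).
split.
- move=> l0.
  have := @ratio_cvg 0 l0 (lexx _).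
  rewrite oppr0 expR0 powR1 mulr1; apply.
  by rewrite mulr_gt0// divr_gt0; lra.
- move=> l lE /andP[l_gt0 l_lt] q Lambda ratio.
  have := @ratio_cvg l lE (ltW l_gt0) l_lt.
  have -> : (a - b * expR (- l) `^ (- (beta / (beta - 1)))) `^ (- (beta - 1)^-1)
      = Lambda.
    rewrite /Lambda /q opprB addrCA subrr addr0 div1r; congr ((a - b * _) `^ _).
    by rewrite -[in RHS]powR_inv1 ?expR_ge0// -powRrM mulN1r.
  move=> /cvg_limf[lo up]; split=> //; first exact: limf_einf_le_esup.
  by apply: le_lt_trans up _; rewrite ltry.
- move=> l lE l_gt.
  have sigma_l : sigma t / t @[t --> +oo] --> l.
    by apply: (@fine_cvg _ _ _ _ (fun t => (sigma t / t)%:E)); rewrite -lE.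
  have l0 : 0 < l.
    by apply: le_lt_trans l_gt; rewrite mulr_ge0 ?ltW// divr_gt0//; lra.
  (* Any value strictly between mu (beta - 1) and l works. *)
  pose lam := (beta^-1 * ln (a / b) * (beta - 1) + l) / 2.
  have mulE : beta^-1 * ln (a / b) * (beta - 1) = (beta - 1) / beta * ln (a / b).
    by ring.
  have lnS := cvg_ln_clock SE sigma_gt0 sigma_int_lim sigma_l.
  have log_S : ln (x t) / S t @[t --> +oo] --> - (beta^-1 * ln (a / b)).
    apply: (@log_cvg lam); first by rewrite /lam; lra.
    have lam_lt : lam < l by rewrite /lam; lra.
    apply: filterS2 t_gt0 (cvgr_ge _ sigma_l _ lam_lt) => t t0.
    by rewrite ler_pdivlMr.
  have -> : - (beta^-1 * l^-1 * ln (a / b)) = - (beta^-1 * ln (a / b)) * l^-1 by ring.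
  have H : (ln (x t) / S t) * (ln t / S t)^-1 @[t --> +oo] -->
      - (beta^-1 * ln (a / b)) * l^-1.
    by apply: cvgM => //; apply: cvgV => //; rewrite gt_eqF.
  apply: cvg_trans H; apply: near_eq_cvg.
  apply: filterS2 (cvgry_gt sigma_int_lim 0) (nbhs_pinfty_gt (num_real 1)) => t St t1.
  have lnt : 0 < ln t by exact: ln_gt0.
  by field; rewrite !gt_eqF.
- move=> ly.
  apply: (@log_cvg (beta^-1 * ln (a / b) * (beta - 1) + 1)); first lra.
  have H : (sigma t / t)%:E @[t --> +oo] --> +oo%E by rewrite -ly.
  have H' : \forall t \near +oo,
      ((beta^-1 * ln (a / b) * (beta - 1) + 1)%:E <= (sigma t / t)%:E)%E.
    exact: (cvgeyPge _).1 H _.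
  by apply: filterS2 t_gt0 H' => t t0; rewrite lee_fin ler_pdivlMr.
Qed.
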